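(* Assume (A1)–(A5) hold and that the aggregator satisfies the robustness property (R) at every iteration. Let $$A=\frac{48BL^2c\delta}{p}+\frac{6(1-p)}{p}\Big(\frac{4c\delta}{p}+\frac{1}{2G}\Big)\Big(\omega L^2+\frac{(1+\omega)\mathcal L_\pm^2}{b}\Big)+\frac{6(1-p)}{p}\Big(\frac{4c\delta(1+\omega)}{p}+\frac{\omega}{2G}\Big)L_\pm^2,$$ and suppose $96cB\delta<p$ and $$0<\gamma\le\min\Big\{\frac{1}{L+\sqrt{2A}},\ \frac{p}{4\mu\big(1-\frac{96Bc\delta}{p}\big)}\Big\}.$$ Then for every $K\ge0$ the iterates of Byz-VR-MARINA satisfy $$\mathbb E[f(x^K)-f(x^* )]\le\Big(1-\gamma\mu\Big(1-\frac{96Bc\delta}{p}\Big)\Big)^K\mathbb E[\Phi_0]+\frac{24c\delta\zeta^2}{\mu(p-96Bc\delta)},$$ where $\Phi_0=f(x^0)-f(x^* )+\frac{2\gamma}{p}\|g^0-\nabla f(x^0)\|^2$ and $f(x^* )=\min f$.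
   Context: Setting. There are $n$ workers indexed by $[n]=\mathcal G\sqcup\mathcal B$: $\mathcal G$ is the set of good workers, $G=|\mathcal G|\ge2$, and $\mathcal B$ is the set of Byzantine workers with $|\mathcal B|\le\delta n$, $0\le\delta<1/2$. For $i\in\mathcal G$, $f_i(x)=\frac1m\sum_{j=1}^m f_{i,j}(x)$ with differentiable $f_{i,j}:\mathbb R^d\to\mathbb R$, and $f=\frac1G\sum_{i\in\mathcal G}f_i$. All expectations $\mathbb E$ are full expectations. (A1) $f$ is $L$-smooth ($\|\nabla f(x)-\nabla f(y)\|\le L\|x-y\|$ for all $x,y$) and $f_*=\inf_x f(x)>-\infty$. (A2) ($(B,\zeta^2)$-heterogeneity) For some $B,\zeta\ge0$: $\frac1G\sum_{i\in\mathcal G}\|\nabla f_i(x)-\nabla f(x)\|^2\le B\|\nabla f(x)\|^2+\zeta^2$ for all $x$. (A3) (global Hessian variance) For some $L_\pm\ge0$: $\frac1G\sum_{i\in\mathcal G}\|\nabla f_i(x)-\nabla f_i(y)\|^2-\|\nabla f(x)-\nabla f(y)\|^2\le L_\pm^2\|x-y\|^2$ for all $x,y$. (A4) (local Hessian variance) There is a batch size $b\ge1$ and, for each $i\in\mathcal G$ and $x,y$, a random vector $\widehat\Delta_i(x,y)$ with $\mathbb E[\widehat\Delta_i(x,y)]=\Delta_i(x,y):=\nabla f_i(x)-\nabla f_i(y)$ and $\frac1G\sum_{i\in\mathcal G}\mathbb E\|\widehat\Delta_i(x,y)-\Delta_i(x,y)\|^2\le\frac{\mathcal L_\pm^2}{b}\|x-y\|^2$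 for some $\mathcal L_\pm\ge0$. (A5) (Polyak–Łojasiewicz) For some $\mu>0$ and all $x$, there is a minimizer $x^*$ of $f$ with $\|\nabla f(x)\|^2\ge2\mu(f(x)-f(x^* ))$. Compressor: $\mathcal Q:\mathbb R^d\to\mathbb R^d$ is a stochastic map with $\mathbb E[\mathcal Q(x)]=x$ and $\mathbb E\|\mathcal Q(x)-x\|^2\le\omega\|x\|^2$ for all $x$, for some $\omega\ge0$. Algorithm Byz-VR-MARINA with stepsize $\gamma>0$, probability $p\in(0,1]$, start $x^0$, and initial vector $g^0\in\mathbb R^d$ (possibly random). For $k=0,1,2,\dots$: draw $c_k\sim\mathrm{Bernoulli}(p)$ independently of everything else; set $x^{k+1}=x^k-\gamma g^k$; each good worker $i\in\mathcal G$ sets $g_i^{k+1}=\nabla f_i(x^{k+1})$ if $c_k=1$ and $g_i^{k+1}=g^k+\mathcal Q(\widehat\Delta_i(x^{k+1},x^k))$ if $c_k=0$, where, conditionally on the past and on $c_k$, the estimators $\widehat\Delta_i$ and the compressions are sampled freshly and independently across $i\in\mathcal G$ (the compression being applied with fresh randomness to its input); each Byzantine worker $i\in\mathcal B$ sends an arbitrary vector $g_i^{k+1}$ (which may depend on everything); finally $g^{k+1}=\mathrm{ARAgg}(g_1^{k+1},\dots,g_n^{k+1})$. Robustness property (R) of the aggregator, with constant $c>0$: for every $k\ge0$, $\mathbb E\|g^{k+1}-\bar g^{k+1}\|^2\le\frac{c\delta}{G(G-1)}\sum_{i,l\in\mathcal G}\mathbb E\|g_i^{k+1}-g_l^{k+1}\|^2$,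 where $\bar g^{k+1}=\frac1G\sum_{i\in\mathcal G}g_i^{k+1}$. *)

(* Defs.v *)
From HB Require Import structures.
From mathcomp Require Import all_boot all_order all_algebra.
From mathcomp Require Import all_classical all_reals all_analysis.
Set Implicit Arguments. Unset Strict Implicit. Unset Printing Implicit Defensive.
Import Order.TTheory GRing.Theory Num.Theory.
Import numFieldNormedType.Exports.
Local Open Scope ring_scope.
Local Open Scope classical_set_scope.

Definition sqn (R : realType) (d : nat) (v : 'rV[R]_d) : R :=
  \sum_(j < d) v 0 j ^+ 2.

Definition enorm (R : realType) (d : nat) (v : 'rV[R]_d) : R :=
  Num.sqrt (sqn v).

(* gradient: the vector of partial derivatives (for differentiable h this is
   the usual gradient, 'd h x v = <grad h x, v>) *)
Definition grad (R : realType) (d : nat) (h : 'rV[R]_d -> R) (x : 'rV[R]_d)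
  : 'rV[R]_d := \row_(j < d) ('D_(delta_mx 0 j) h x).

(* the Borel sigma-algebra of R^d, i.e. the one generated by the coordinate maps;
   vecM R d is 'rV[R]_d seen as a measurable space *)
Definition coord_gen (R : realType) (d : nat) : set (set 'rV[R]_d) :=
  \bigcup_(j in [set: 'I_d])
     preimage_set_system setT (fun v : 'rV[R]_d => v 0 j) measurable.
Definition vecM (R : realType) (d : nat) := g_sigma_algebraType (@coord_gen R d).

Definition vec_meas_wrt (T : Type) (R : realType) (d : nat) (F : set (set T))
  (X : T -> 'rV[R]_d) : Prop :=
  forall (j : 'I_d) (B : set R), measurable B -> F ((fun w => X w 0 j) @^-1` B).

Definition mutually_independent d (T : measurableType d) (R : realType)
  (P : probability T R) (I : eqType) (F : I -> set (set T)) : Prop :=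
  (forall i, F i `<=` measurable) /\
  forall (J : seq I) (A : I -> set T), uniq J -> (forall j, j \in J -> F j (A j)) ->
    P (\big[setI/setT]_(j <- J) A j) = (\prod_(j <- J) P (A j))%E.

(* Indices of the sources of randomness of Byz-VR-MARINA:
     None                  : the initial sigma-algebra F0 (randomness of g^0 and
                             of the Byzantine workers)
     Some (k, None)        : the coin c_k
     Some (k, Some (i,true))  : the seed of the estimator \hat\Delta_i at step k
     Some (k, Some (i,false)) : the seed of the compression of worker i at step k *)
Definition sidx (n : nat) := option (nat * option ('I_n * bool))%type.

Definition trivial_sys (T : Type) : set (set T) := [set A | A = set0 \/ A = setT].

Definition bvr_sys d (Om : measurableType d) dS (S : measurableType dS)
  dU (U : measurableType dU) (n : nat) (good : {set 'I_n})
  (F0 : set (set Om)) (c : nat -> Om -> bool) (xi : nat -> 'I_n -> Om -> S)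
  (eta : nat -> 'I_n -> Om -> U) (j : sidx n) : set (set Om) :=
  match j with
  | None => F0
  | Some (k, None) => preimage_set_system setT (c k) measurable
  | Some (k, Some (i, true)) =>
      if i \in good then preimage_set_system setT (xi k i) measurable
      else @trivial_sys Om
  | Some (k, Some (i, false)) =>
      if i \in good then preimage_set_system setT (eta k i) measurable
      else @trivial_sys Om
  end.

Definition bvr_past d (Om : measurableType d) dS (S : measurableType dS)
  dU (U : measurableType dU) (n : nat) (good : {set 'I_n})
  (F0 : set (set Om)) (c : nat -> Om -> bool) (xi : nat -> 'I_n -> Om -> S)
  (eta : nat -> 'I_n -> Om -> U) (k : nat) : set (set Om) :=
  <<s F0 `|` [set A | exists k' t, (k' < k)%N /\
                  bvr_sys good F0 c xi eta (Some (k', t)) A] >>.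

(* Main.v *)
Require Import Defs.
From HB Require Import structures.
From mathcomp Require Import all_boot all_order all_algebra.
From mathcomp Require Import all_classical all_reals all_analysis.
From mathcomp Require Import measurable_realfun ring lra.
Import Order.TTheory GRing.Theory Num.Theory.
Import numFieldNormedType.Exports.
Local Open Scope ring_scope.
Local Open Scope classical_set_scope.

Set Implicit Arguments. Unset Strict Implicit. Unset Printing Implicit Defensive.

(** The Lyapunov function is [f (x k) - f xs + 2 gamma / p * sqn (g k - grad f (x k))].
    Smoothness and the Polyak-Lojasiewicz inequality control its first term. For
    the second, the mean of the good messages minus the gradient vanishes when
    the coin is 1; otherwise it is the previous error plus an average of noises
    [Q (Dhat i) - Delta i]. Each noise splits into a compression part and a
    sampling part, each centred given all the other sources of randomness, so
    these parts are pairwise uncorrelated and uncorrelated with the past, and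
    second moments add up. The same computation bounds the pairwise distances
    of the good messages, hence the aggregation error. *)

(** * Vectors and gradients *)

(** The aggregator and the Byzantine messages are arbitrary, so nothing about [g k.+1] is explicit:
    its square integrability, like its distance to the mean of the good messages, comes only from
    the robustness bound, once the right side of that bound is known to be finite. Finiteness of
    second moments is therefore carried through the iteration together with the variance recursion,
    starting from a finite mean of Phi_0; if that mean is infinite the claim is trivial.

    Conditioning on the coin is replaced by multiplication with its indicator, which equals its own
    square and, by independence, contributes a factor [p] or [1 - p].

    The constants have two origins. Young's inequality with parameter [p / 2] separates the
    aggregation error from the error of the mean and turns the factor [1 - p] into [1 - p / 2]. The
    weight [2 * gamma / p] then makes the error lose [gamma * e] per step: half of it pays for the
    term [gamma / 2 * e] of the descent inequality, the other half is a contraction by [p / 4], and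
    the second stepsize bound says that [gamma * mu * rho] is at most that. *)

Definition dot (R : realType) (d : nat) (u v : 'rV[R]_d) : R :=
  \sum_(j < d) u 0 j * v 0 j.

Section euclidean.
Context (R : realType) (d : nat).
Implicit Types (u v : 'rV[R]_d) (a : R).

Lemma sqn_dot u : sqn u = dot u u.
Proof. by apply: eq_bigr => j _; rewrite expr2. Qed.

Lemma dotC u v : dot u v = dot v u.
Proof. by apply: eq_bigr => j _; rewrite mulrC. Qed.

Lemma dotDl u v w : dot (u + v) w = dot u w + dot v w.
Proof. by rewrite -big_split /=; apply: eq_bigr => j _; rewrite mxE mulrDl. Qed.

Lemma dotZl a u v : dot (a *: u) v = a * dot u v.
Proof. by rewrite mulr_sumr; apply: eq_bigr => j _; rewrite mxE mulrA. Qed.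

Lemma dotNl u v : dot (- u) v = - dot u v.
Proof. by rewrite -scaleN1r dotZl mulN1r. Qed.

Lemma dot0l v : dot 0 v = 0.
Proof. by rewrite -(scale0r 0) dotZl mul0r. Qed.

Lemma dotDr u v w : dot u (v + w) = dot u v + dot u w.
Proof. by rewrite dotC dotDl !(dotC u). Qed.

Lemma dotZr a u v : dot u (a *: v) = a * dot u v.
Proof. by rewrite dotC dotZl dotC. Qed.

Lemma dotNr u v : dot u (- v) = - dot u v.
Proof. by rewrite dotC dotNl dotC. Qed.

Lemma dot_suml (I : Type) (r : seq I) (p : pred I) (F : I -> 'rV[R]_d) v :
  dot (\sum_(i <- r | p i) F i) v = \sum_(i <- r | p i) dot (F i) v.
Proof.
apply: (big_morph (fun u => dot u v)); first by move=> u w; rewrite dotDl.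
exact: dot0l.
Qed.

Lemma sqn_ge0 u : 0 <= sqn u.
Proof. by apply: sumr_ge0 => j _; exact: sqr_ge0. Qed.

Lemma sqnD u v : sqn (u + v) = sqn u + 2 * dot u v + sqn v.
Proof. by rewrite !sqn_dot dotDl !dotDr (dotC v u); ring. Qed.

Lemma sqnZ a u : sqn (a *: u) = a ^+ 2 * sqn u.
Proof. by rewrite !sqn_dot dotZl dotZr; ring. Qed.

Lemma sqnN u : sqn (- u) = sqn u.
Proof. by rewrite -scaleN1r sqnZ sqrrN expr1n mul1r. Qed.

Lemma sqn0 : sqn (0 : 'rV[R]_d) = 0.
Proof. by rewrite sqn_dot dot0l. Qed.

Lemma sqnB u v : sqn (u - v) = sqn u - 2 * dot u v + sqn v.
Proof. by rewrite sqnD sqnN dotNr; ring. Qed.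

Lemma sqn_eq0 u : sqn u = 0 -> u = 0.
Proof.
move=> /eqP; rewrite psumr_eq0 => [/allP u0|j _]; last exact: sqr_ge0.
apply/rowP => j; rewrite mxE; apply/eqP; rewrite -sqrf_eq0.
by apply: (u0 j); rewrite mem_index_enum.
Qed.

Lemma dot_young a u v : 0 < a -> 2 * dot u v <= a * sqn u + a^-1 * sqn v.
Proof.
move=> a0; have := sqn_ge0 (a *: u - v); rewrite sqnB sqnZ dotZl => h.
rewrite -(ler_pM2l a0) mulrDr !mulrA divff ?gt_eqF// mul1r; lra.
Qed.

Lemma sqnD_young a u v : 0 < a ->
  sqn (u + v) <= (1 + a) * sqn u + (1 + a^-1) * sqn v.
Proof. by move=> a0; have := dot_young u v a0; rewrite sqnD; lra. Qed.

Lemma sqnD_le u v : sqn (u + v) <= 2 * sqn u + 2 * sqn v.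
Proof. by have := sqnD_young u v ltr01; rewrite invr1; lra. Qed.

Lemma dot_abs_le u v : `|dot u v| <= sqn u + sqn v.
Proof.
have := dot_young u v ltr01; have := dot_young (- u) v ltr01.
rewrite invr1 dotNl sqnN ler_norml => h1 h2.
by have := sqn_ge0 u; have := sqn_ge0 v => h3 h4; apply/andP; split; lra.
Qed.

Lemma coord_sqr_le_sqn u j : (u 0 j) ^+ 2 <= sqn u.
Proof.
rewrite /sqn (bigD1 j)//= lerDl; apply: sumr_ge0 => k _; exact: sqr_ge0.
Qed.

Lemma enorm_le_sqn L u v : enorm u <= L * enorm v -> sqn u <= L ^+ 2 * sqn v.
Proof.
move=> h; rewrite -(sqr_sqrtr (sqn_ge0 u)) -(sqr_sqrtr (sqn_ge0 v)) -exprMn.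
have u0 : 0 <= enorm u := sqrtr_ge0 _.
by rewrite ler_pXn2r ?nnegrE//; exact: le_trans h.
Qed.

(** Deviations from the mean sum to zero, so the cross terms of the expanded squares cancel. This
    converts the pairwise distances of the robustness property into the deviations from the mean
    that (A2) and (A3) control. *)
Lemma sum_sqn_sub (I : finType) (S : {set I}) (F : I -> 'rV[R]_d) :
  let mean := #|S|%:R^-1 *: \sum_(i in S) F i in
  \sum_(i in S) \sum_(l in S) sqn (F i - F l) =
    2 * #|S|%:R * \sum_(i in S) sqn (F i - mean).
Proof.
move=> mean.
have [S0|S0] := eqVneq #|S| 0%N.
  rewrite S0 mulr0 mul0r big1// => i iS.
  by move: iS; rewrite (cards0_eq S0) inE.
have nz : (#|S|%:R : R) != 0 by rewrite pnatr_eq0.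
pose V i := F i - mean.
have sV : \sum_(i in S) V i = 0.
  by rewrite sumrB sumr_const -scaler_nat /mean scalerA divff// scale1r subrr.
transitivity (\sum_(i in S) \sum_(l in S) (sqn (V i) - 2 * dot (V i) (V l) + sqn (V l))).
  apply: eq_bigr => i _; apply: eq_bigr => l _; rewrite -sqnB /V.
  by congr sqn; rewrite opprB addrA subrK.
have -> : \sum_(i in S) \sum_(l in S) (sqn (V i) - 2 * dot (V i) (V l) + sqn (V l))
  = \sum_(i in S) (#|S|%:R * sqn (V i) + \sum_(l in S) sqn (V l)).
  apply: eq_bigr => i _; rewrite big_split sumrB /= sumr_const -[sqn (V i) *+ _]mulr_natl.
  congr (_ + _); rewrite -mulr_sumr.
  have -> : \sum_(l in S) dot (V i) (V l) = 0.
    by rewrite (eq_bigr (fun l => dot (V l) (V i))) -?dot_suml ?sV ?dot0l// => l _; exact: dotC.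
  by rewrite mulr0 subr0.
by rewrite big_split /= sumr_const -[(\sum_(_ in _) _) *+ _]mulr_natl -mulr_sumr; ring.
Qed.

(** The bias-variance identity. Applied to gradient differences, its right side is [#|S|] times the
    left side of (A3). *)
Lemma sum_sqn_dev (I : finType) (S : {set I}) (F : I -> 'rV[R]_d) :
  let mean := #|S|%:R^-1 *: \sum_(i in S) F i in (0 < #|S|)%N ->
  \sum_(i in S) sqn (F i - mean) = \sum_(i in S) sqn (F i) - #|S|%:R * sqn mean.
Proof.
move=> mean S0; have nz : (#|S|%:R : R) != 0 by rewrite pnatr_eq0 -lt0n.
under eq_bigr do rewrite sqnB.
rewrite big_split sumrB /= sumr_const -[sqn mean *+ _]mulr_natl -mulr_sumr -dot_suml.
have -> : \sum_(i in S) F i = #|S|%:R *: mean by rewrite scalerA divff// scale1r.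
by rewrite dotZl -sqn_dot; ring.
Qed.

End euclidean.

(** * Gradients, the descent lemma, continuity *)

Section gradient.
Context (R : realType) (d : nat).
Implicit Types (h : 'rV[R]_d -> R) (x y v : 'rV[R]_d).

Lemma derive_grad h x v : differentiable h x -> 'D_v h x = dot (grad h x) v.
Proof.
move=> dh; rewrite deriveE// {1}(row_sum_delta v) linear_sum /=.
by apply: eq_bigr => j _; rewrite linearZ /= mxE deriveE// mulrC.
Qed.

Lemma is_derive_line h x v (t : R) : differentiable h (x + t *: v) ->
  is_derive t 1 (fun s => h (x + s *: v)) (dot (grad h (x + t *: v)) v).
Proof.
move=> dh; have E : (fun k : R => k^-1 *: (((fun s => h (x + s *: v)) \o shift t) (k *: 1)
    - h (x + t *: v))) =
  (fun k => k^-1 *: ((h \o shift (x + t *: v)) (k *: v) - h (x + t *: v))).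
  apply/funext => k /=; congr (_ *: (h _ - _)).
  have -> : k *: (1 : R) = k by exact: mulr1.
  by rewrite scalerDl addrCA.
split; first by rewrite /derivable E; exact: (diff_derivable dh).
by rewrite /derive E -derive_grad.
Qed.

(** [psi] is [h] along the segment minus its quadratic upper model. Its derivative is nonpositive on
    nonnegative [s], so the mean value theorem gives [psi 1 <= psi 0], which is the claim; no
    integral of the gradient is involved. *)
Lemma differentiable_descent h (L : R) x y : 0 <= L ->
  (forall z, differentiable h z) ->
  (forall z z', sqn (grad h z - grad h z') <= L ^+ 2 * sqn (z - z')) ->
  h y <= h x + dot (grad h x) (y - x) + L / 2 * sqn (y - x).
Proof.
move=> L0 dh hL; have [v ->] : exists v : 'rV[R]_d, y = x + v.
  by exists (y - x); rewrite addrC subrK.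
have -> : x + v - x = v by rewrite addrAC subrr add0r.
pose psi := fun s : R => h (x + s *: v) - s * dot (grad h x) v - L / 2 * s ^+ 2 * sqn v.
pose dpsi := fun s : R => dot (grad h (x + s *: v)) v - dot (grad h x) v - L * s * sqn v.
have dps (s : R) : is_derive s (1 : R) psi (dpsi s).
  have := is_derive_line (dh (x + s *: v)) => ?.
  rewrite /psi /dpsi; apply: is_derive_eq.
  by rewrite /GRing.scale /=; field.
have dpsi_le0 s : 0 <= s -> dpsi s <= 0.
  move=> s0; rewrite /dpsi -dotNl -dotDl.
  have := hL (x + s *: v) x; rewrite addrAC subrr add0r sqnZ mulrA -exprMn.
  (* Young's inequality with parameter [(L * s)^-1] plays the role of Cauchy-Schwarz. It requires
     [L * s] to be positive; otherwise the Lipschitz bound makes the gradient increment [w]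
     vanish. *)
  set w := _ - _ => hw; have [Ls0|Ls] := eqVneq (L * s) 0.
    have w0 : sqn w = 0 by apply/eqP; rewrite eq_le sqn_ge0 andbT (le_trans hw)// Ls0 expr0n/= mul0r.
    by rewrite (sqn_eq0 w0) dot0l Ls0 mul0r subrr.
  have Lsp : 0 < L * s by rewrite lt_neqAle eq_sym Ls mulr_ge0.
  have := @dot_young _ _ (L * s)^-1 w v; rewrite invr_gt0 invrK => /(_ Lsp) hy.
  suff : (L * s)^-1 * sqn w <= L * s * sqn v by lra.
  by rewrite -(ler_pM2l Lsp) mulrA divff// mul1r mulrA -expr2.
have cpsi : {within `[0, 1], continuous psi}.
  apply: derivable_within_continuous => s _; exact: (@ex_derive _ _ _ _ _ _ _ (dps s)).
have [s /[!in_itv]/= /andP[s0 s1]] := MVT ltr01 (fun s _ => dps s) cpsi.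
rewrite subr0 mulr1 => E.
have := dpsi_le0 s (ltW s0); rewrite -E /psi scale0r scale1r addr0; lra.
Qed.

Lemma grad_const (c : R) x : grad (fun=> c) x = 0 :> 'rV[R]_d.
Proof. by apply/rowP => j; rewrite !mxE; exact: derive_cst. Qed.

Lemma gradD h1 h2 x : differentiable h1 x -> differentiable h2 x ->
  grad (fun y => h1 y + h2 y) x = grad h1 x + grad h2 x.
Proof.
move=> d1 d2; apply/rowP => j; rewrite !mxE.
by rewrite -deriveD//; exact: diff_derivable.
Qed.

Lemma differentiable_bigsum (I : Type) (r : seq I) (p : pred I)
    (F : I -> 'rV[R]_d -> R) x : (forall i, p i -> differentiable (F i) x) ->
  differentiable (fun y => \sum_(i <- r | p i) F i y) x /\
  grad (fun y => \sum_(i <- r | p i) F i y) x = \sum_(i <- r | p i) grad (F i) x.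
Proof.
move=> dF; elim: r => [|a r [IH1 IH2]].
  have -> : (fun y => \sum_(i <- [::] | p i) F i y) = cst 0.
    by apply/funext => y; rewrite big_nil.
  by rewrite big_nil grad_const; split => //; exact: differentiable_cst.
have -> : (fun y => \sum_(i <- a :: r | p i) F i y) =
    (fun y => if p a then F a y + \sum_(i <- r | p i) F i y
              else \sum_(i <- r | p i) F i y).
  by apply/funext => y; rewrite big_cons.
rewrite big_cons; case: ifPn => pa //; split; last by rewrite gradD// ?IH2//; exact: dF.
by apply: differentiableD => //; exact: dF.
Qed.

Lemma gradZ (a : R) h x : differentiable h x ->
  grad (fun y => a * h y) x = a *: grad h x.
Proof.
move=> dh; apply/rowP => j; rewrite !mxE.
by rewrite -[RHS]deriveZ//; exact: diff_derivable.
Qed.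

Lemma differentiable_scale (a : R) h x : differentiable h x ->
  differentiable (fun y => a * h y) x.
Proof. by move=> dh; exact: (differentiableZ a dh). Qed.

(** The topology on row vectors is that of the max norm while the bound is Euclidean. The two are
    not compared: [C * sqn (x - z)] is a polynomial in [z], hence continuous, and it is 0 at [x]. *)
Lemma continuous_sqn_lipschitz (F : 'rV[R]_d -> 'rV[R]_d) (C : R) j :
  (forall y z, sqn (F y - F z) <= C * sqn (y - z)) ->
  continuous (fun y => F y 0 j).
Proof.
move=> hF x; apply/(@cvgrPdist_lt R R _ (nbhs x) (nbhs_filter x)) => e e0.
have /differentiable_continuous csqn :
    differentiable (fun z : 'rV[R]_d => C * \sum_(k < d) (x 0 k - z 0 k) ^+ 2) x.
  apply: differentiable_scale; apply: (differentiable_bigsum _ _).1 => k _.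
  apply: (@differentiableX _ _ (fun z : 'rV[R]_d => x 0 k - z 0 k) 1).
  by apply: differentiableB; [exact: differentiable_cst|exact: differentiable_coord].
move/(@cvgrPdist_lt R R _ (nbhs x) (nbhs_filter x)): csqn => /(_ (e ^+ 2) (exprn_gt0 _ e0)).
have sqnE (z : 'rV[R]_d) : \sum_(k < d) (x 0 k - z 0 k) ^+ 2 = sqn (x - z).
  by apply: eq_bigr => k _; rewrite !mxE.
have E0 : C * sqn (x - x) = 0 by rewrite subrr sqn0 mulr0.
apply: filterS => z /=; rewrite !sqnE E0 sub0r normrN => hz.
rewrite -(@ltr_pXn2r _ 2)// ?nnegrE ?(ltW e0)//.
apply: le_lt_trans hz; rewrite real_normK ?num_real//.
apply: le_trans (ler_norm _); apply: le_trans (hF x z).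
by have := coord_sqr_le_sqn (F x - F z) j; rewrite !mxE.
Qed.

End gradient.

(** * Measurability *)

Section measurable_vectors.
Context (R : realType) (d : nat) (dT : measure_display) (T : measurableType dT).
Implicit Types X Y : T -> 'rV[R]_d.

Definition vec_measurable X := forall j, measurable_fun setT (fun w => X w 0 j).

Lemma vec_measurable_vecM X : vec_measurable X <->
  measurable_fun setT (X : T -> vecM R d).
Proof.
split=> [mX|mX j].
  apply: (@measurability _ _ _ (vecM R d) _ _ (@coord_gen R d)) => //.
  move=> _ [_ [j _ [B mB <-]] <-]; rewrite !setTI.
  by have := mX j measurableT B mB; rewrite setTI.
move=> _ B mB; rewrite setTI.
have := mX measurableT ((fun v : vecM R d => (v : 'rV[R]_d) 0 j) @^-1` B).
rewrite setTI; apply; apply: sub_sigma_algebra; exists j => //.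
by exists B => //; rewrite setTI.
Qed.

(** Measurability is only known coordinate by coordinate, so an open set has to be written as a
    countable union of boxes with rational centres. *)
Lemma vec_measurable_continuous X (h : 'rV[R]_d -> R) :
  vec_measurable X -> continuous h -> measurable_fun setT (fun w => h (X w)).
Proof.
move=> mX /continuousP ch.
apply: (measurability _ (RGenOpens.measurableE R)).
move=> _ [_ [a [b ->] <-]]; rewrite setTI.
have [U oU ->] : exists2 U : set 'rV[R]_d, open U &
    (fun w => h (X w)) @^-1` `]a, b[%classic = X @^-1` U.
  by exists (h @^-1` `]a, b[%classic); [apply: ch; exact: interval_open|].
(* A box is coded by a rational centre and a radius [1 / (k + 1)]. The union below keeps only the
   boxes contained in [U]; a radius below [e / 2] and a centre within that radius of [X w] put the
   box inside the [e]-ball around [X w]. *)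
pose box (u : 'rV[rat]_d * nat) : set 'rV[R]_d :=
  [set z | forall j, `|ratr (u.1 0 j) - z 0 j| < u.2.+1%:R^-1].
have -> : X @^-1` U = \bigcup_(u : 'rV[rat]_d * nat)
    (if `[< box u `<=` U >] then X @^-1` (box u) else set0).
  apply/seteqP; split => [w /= Uw|w [u _]]; last by case: asboolP => // + wu; exact.
  have : nbhs (X w) U by apply: open_nbhs_nbhs.
  move=> /nbhs_ballP[e /= e0 beU].
  have [k ke] : exists k : nat, k.+1%:R^-1 < e / 2 :> R.
    by near \oo => k; exists k; near: k; apply: near_infty_natSinv_lt (PosNum (divr_gt0 e0 (ltr0n _ 2))).
  have k0 : 0 < k.+1%:R^-1 :> R by rewrite invr_gt0.
  have hq j : exists q : rat, `|ratr q - X w 0 j| < k.+1%:R^-1.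
    have : X w 0 j - k.+1%:R^-1 < X w 0 j + k.+1%:R^-1 by rewrite ltrBlDr -addrA ltrDl addr_gt0.
    move=> /rat_in_itvoo[q]; rewrite in_itv /= => /andP[q1 q2].
    by exists q; rewrite ltr_distl q1.
  have [q qP] := choice hq.
  exists (\row_j q j, k) => //; case: asboolP => [_|]; first by move=> j /=; rewrite mxE.
  case=> z zb; apply: beU; split=> // i j; rewrite ord1 /ball/=.
  have := zb j; have := qP j; rewrite /= mxE => h1 h2.
  have -> : X w 0 j - z 0 j = (ratr (q j) - z 0 j) - (ratr (q j) - X w 0 j) by ring.
  by apply: le_lt_trans (ler_normB _ _) _; rewrite (splitr e) ltrD// (lt_trans _ ke).
apply: (@countable_bigcupT_measurable _ _ ('rV[rat]_d * nat)%type); first exact: countableP.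
move=> u; case: asboolP => // _.
have -> : X @^-1` box u = \bigcap_(j in [set: 'I_d])
    ((fun w => X w 0 j) @^-1` `]ratr (u.1 0 j) - u.2.+1%:R^-1, ratr (u.1 0 j) + u.2.+1%:R^-1[%classic).
  apply/seteqP; split => w /= hw j.
    by move=> _; have := hw j; rewrite /= in_itv /= distrC ltr_distl.
  by have := hw j I; rewrite /= in_itv /= distrC ltr_distl.
apply: fin_bigcap_measurable => // j _; rewrite -[X in measurable X]setTI.
by apply: mX => //; exact: measurable_itv.
Unshelve. all: by end_near. Qed.

Lemma vec_measurableD X Y : vec_measurable X -> vec_measurable Y ->
  vec_measurable (fun w => X w + Y w).
Proof.
move=> mX mY j; under eq_fun do rewrite mxE.
exact: measurable_funD.
Qed.

Lemma vec_measurableZ X (a : T -> R) : measurable_fun setT a ->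
  vec_measurable X -> vec_measurable (fun w => a w *: X w).
Proof.
move=> ma mX j; under eq_fun do rewrite mxE.
exact: measurable_funM.
Qed.

Lemma vec_measurableN X : vec_measurable X -> vec_measurable (fun w => - X w).
Proof.
move=> mX; have := vec_measurableZ (measurable_cst (-1 : R)) mX.
by under eq_fun do rewrite scaleN1r.
Qed.

Lemma vec_measurableB X Y : vec_measurable X -> vec_measurable Y ->
  vec_measurable (fun w => X w - Y w).
Proof. by move=> mX mY; apply: vec_measurableD => //; exact: vec_measurableN. Qed.

Lemma measurable_dot X Y : vec_measurable X -> vec_measurable Y ->
  measurable_fun setT (fun w => dot (X w) (Y w)).
Proof. by move=> mX mY; apply: measurable_sum => j; exact: measurable_funM. Qed.

Lemma measurable_sqn X : vec_measurable X -> measurable_fun setT (fun w => sqn (X w)).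
Proof. by move=> mX; under eq_fun do rewrite sqn_dot; exact: measurable_dot. Qed.

End measurable_vectors.

(** * Independence *)

(** A pi-lambda argument. Mutual independence speaks of finite intersections only; those avoiding
    the index [j] form a pi-system generating the sigma-algebra of all other sources. *)
Lemma mutually_independent_rest d (T : measurableType d) (R : realType)
    (P : probability T R) (I : eqType) (F : I -> set (set T)) (j : I) (A B : set T) :
  mutually_independent P F -> (forall i, sigma_algebra setT (F i)) ->
  <<s \bigcup_(i in [set i | i != j]) F i >> A -> F j B ->
  P (A `&` B) = (P A * P B)%E.
Proof.
move=> [Fm FP] sF sA FB.
have FT i : F i setT by have [F0 FC _] := sF i; rewrite -(setD0 setT); exact: FC.
have FI i : setI_closed (F i).
  have := @sigma_algebra_measurable; move=> _ X Y FX FY.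
  have := @measurableI _ (g_sigma_algebraType (F i)) X Y.
  by rewrite /measurable /= sigma_algebra_id//; exact.
(* The sets [a i] are required to lie in [F i] for every [i], not just on [J], so that two families
   can be intersected index by index; [PiE] pads with [setT]. *)
pose Pi : set (set T) := [set C | exists J (a : I -> set T), [/\ uniq J, j \notin J,
  (forall i, F i (a i)) & C = \big[setI/setT]_(i <- J) a i]].
have PiE C : (exists J (a : I -> set T), [/\ uniq J, j \notin J,
    (forall i, i \in J -> F i (a i)) & C = \big[setI/setT]_(i <- J) a i]) -> Pi C.
  move=> [J [a [uJ jJ Fa ->]]]; exists J, (fun i => if i \in J then a i else setT).
  split => //; first by move=> i; case: ifPn => // /Fa.
  by rewrite big_seq_cond [RHS]big_seq_cond; apply: eq_bigr => i /andP[-> _].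
have bigIE (J : seq I) (a : I -> set T) w :
    (\big[setI/setT]_(i <- J) a i) w <-> (forall i, i \in J -> a i w).
  elim: J => [|k J IH]; first by rewrite big_nil.
  rewrite big_cons; split=> [[akw /IH h] i|h].
    by rewrite inE => /orP[/eqP ->//|/h].
  by split; [apply: h; rewrite mem_head|apply/IH => i iJ; apply: h; rewrite inE iJ orbT].
have PiI : setI_closed Pi.
  move=> _ _ [J [a [uJ jJ Fa ->]]] [J' [a' [uJ' jJ' Fa' ->]]].
  exists (undup (J ++ J')), (fun i => (if i \in J then a i else setT) `&`
    (if i \in J' then a' i else setT)); split.
  - exact: undup_uniq.
  - by rewrite mem_undup mem_cat negb_or jJ.
  - by move=> i; apply: FI; case: ifP.
  - apply/seteqP; split => w.
      move=> [/bigIE h /bigIE h']; apply/bigIE => i _.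
      by split; case: ifPn => // iJ; [exact: h|exact: h'].
    move=> /bigIE h; split; apply/bigIE => i iJ.
      by have := h i; rewrite mem_undup mem_cat iJ => /(_ isT)[].
    by have := h i; rewrite mem_undup mem_cat iJ orbT => /(_ isT)[].
have PiM : Pi `<=` measurable.
  move=> _ [J [a [_ _ Fa ->]]]; apply: bigsetI_measurable => i _; exact: Fm (Fa i).
have mB : measurable B by exact: Fm FB.
have sPi : <<s Pi >> A.
  apply: (smallest_sub (smallest_sigma_algebra setT Pi) _ sA).
  move=> C [i /= ij FC]; apply: sub_sigma_algebra; apply: PiE.
  exists [:: i], (fun=> C); split=> //.
  - by rewrite inE eq_sym.
  - by move=> k; rewrite inE => /eqP ->.
  - by rewrite big_seq1.
(* The two finite measures to compare on [Pi] are [P] restricted to [B] and [P] multiplied by the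
   number [P B]. *)
have PB0 : 0 <= fine (P B) by exact: fine_ge0.
have -> : P (A `&` B) = mrestr P mB A by [].
have PBE X : mscale (NngNum PB0) P X = (P X * P B)%E.
  by rewrite /mscale /= muleC fineK// fin_num_measure.
rewrite -PBE.
apply: (@g_sigma_algebra_measure_unique _ _ _ Pi PiM (fun=> setT)) => //.
- move=> _; exists [::], (fun=> setT); split=> //; by rewrite big_nil.
- by rewrite bigcup_const//; exists 0%N.
- move=> C [J [a [uJ jJ Fa ->]]]; apply: etrans (esym (PBE _)).
  (* Placing [B] at the free index [j] turns the intersection with [B] into another finite
     intersection, to which mutual independence applies. *)
  pose a' i := if i == j then B else a i.
  have aE : \big[setI/setT]_(i <- J) a i = \big[setI/setT]_(i <- J) a' i.
    rewrite big_seq_cond [RHS]big_seq_cond; apply: eq_bigr => i /andP[iJ _].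
    by rewrite /a' ifN//; apply: contraNneq jJ => <-.
  have a'j : a' j = B by rewrite /a' eqxx.
  have Fa' i : F i (a' i) by rewrite /a'; case: eqP => [->|].
  rewrite aE; change (P (\big[setI/setT]_(i <- J) a' i `&` B) = (P (\big[setI/setT]_(i <- J) a' i) * P B)%E).
  have -> : \big[setI/setT]_(i <- J) a' i `&` B = \big[setI/setT]_(i <- j :: J) a' i.
    by rewrite big_cons a'j setIC.
  by rewrite !FP//= ?jJ// big_cons a'j muleC.
- move=> _; change (P (setT `&` B) < +oo)%E.
  by rewrite setTI ltey_eq fin_num_measure.
Qed.

(** Conditioning on the sigma-algebra generated by [Gen] is encoded without
    conditional expectations: [T] with that sigma-algebra is a second measurable
    type [T1], and independence of [Y] says that the law of [w |-> (w, Y w)] on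
    [T1 * U] is a product measure. *)
Section fubini_independent.
Context d (T : measurableType d) (R : realType) (P : probability T R).
Context (Gen : set (set T)) (GenM : Gen `<=` measurable).
Context dU (U : measurableType dU) (nu : probability U R).
Context (Y : T -> U) (mY : measurable_fun setT Y).
Hypothesis indep : forall A C, <<s Gen >> A -> measurable C ->
  P (A `&` Y @^-1` C) = (P A * nu C)%E.

Local Notation T1 := (g_sigma_algebraType Gen).

Let toT1 : T -> T1 := idfun.

Lemma measurable_to_sub : measurable_fun setT toT1.
Proof.
move=> _ A sA; rewrite setTI; apply: sA.
by split => //; exact: sigma_algebra_measurable.
Qed.

HB.instance Definition _ := isMeasurableFun.Build _ _ _ _ toT1 measurable_to_sub.

Let m1 : probability T1 R := distribution P toT1.

Let join (w : T) : T1 * U := (toT1 w, Y w).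

Let mjoin : measurable_fun setT join.
Proof. by apply: measurable_fun_pair => //; exact: measurable_to_sub. Qed.

Let joinE (A : set (T1 * U)) : measurable A ->
  pushforward P join A = (m1 \x nu)%E A.
Proof.
move=> mA; rewrite (@product_measure_unique _ _ _ _ _ m1 nu (pushforward P join))//.
Qed.

Lemma indep_fubini_ge0 (h : T1 * U -> \bar R) : measurable_fun setT h ->
  (forall z, 0 <= h z)%E ->
  (\int[P]_w h (w, Y w) = \int[P]_w \int[nu]_u h (w, u))%E.
Proof.
move=> mh h0.
transitivity (\int[pushforward P join]_z h z)%E.
  by rewrite ge0_integral_pushforward.
transitivity (\int[m1 \x nu]_z h z)%E.
  by apply: eq_measure_integral => A mA _; exact: joinE.
rewrite fubini_tonelli1// ge0_integral_pushforward//.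
- exact: measurable_fun_fubini_tonelli_F.
- by move=> z _; exact: integral_ge0.
Qed.

(** The tower property: a variable with conditional mean zero given [Gen] has mean zero. The
    integrand is signed, so integrability must first be transported to the product space before
    Fubini applies. *)
Lemma indep_mean0 (h : T1 * U -> R) : measurable_fun setT h ->
  (forall w, \int[nu]_u (h (w, u))%:E = 0)%E ->
  P.-integrable setT (fun w => (h (w, Y w))%:E) ->
  (\int[P]_w (h (w, Y w))%:E = 0)%E.
Proof.
move=> mh h0 ih.
have mh' : measurable_fun setT (fun z => (h z)%:E) by exact/measurable_EFinP.
transitivity (\int[pushforward P join]_z (h z)%:E)%E.
  by rewrite integral_pushforward.
transitivity (\int[m1 \x nu]_z (h z)%:E)%E.
  by apply: eq_measure_integral => A mA _; exact: joinE.
rewrite -integral12_prod_meas1; last first.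
  apply/integrableP; split=> //.
  have /integrableP[_] := integrable_pushforward mjoin mh' ih measurableT.
  apply: le_lt_trans; rewrite le_eqVlt; apply/orP; left; apply/eqP.
  by apply: eq_measure_integral => A mA _; exact/esym/joinE.
rewrite (eq_integral (cst 0%E)) ?integral0// => w _; exact: h0.
Qed.

End fubini_independent.

(** * Square-integrable random vectors *)

Section square_integrable.
Context dT (T : measurableType dT) (R : realType) (P : probability T R) (d : nat).
Implicit Types (X Y Z : T -> 'rV[R]_d) (f g : T -> R).

Definition L2v X := vec_measurable X /\ (\int[P]_w (sqn (X w))%:E < +oo)%E.

(** A real integral, equal to 0 when the second moment is infinite; this is why the rules for sums
    and multiples carry [L2v] hypotheses. *)
Definition Esqn X : R := \int[P]_w sqn (X w).

Lemma integrable_ge0 f : measurable_fun setT f -> (forall w, 0 <= f w) ->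
  (\int[P]_w (f w)%:E < +oo)%E -> P.-integrable setT (EFin \o f).
Proof.
move=> mf f0 foo; apply/integrableP; split; first exact/measurable_EFinP.
by under eq_integral do rewrite gee0_abs ?lee_fin//=.
Qed.

Lemma integrable_le f g : measurable_fun setT f ->
  (forall w, `|f w| <= g w) -> P.-integrable setT (EFin \o g) ->
  P.-integrable setT (EFin \o f).
Proof.
move=> mf fg; apply: le_integrable => //; first exact/measurable_EFinP.
by move=> w _ /=; rewrite lee_fin (le_trans (fg w))// ler_norm.
Qed.

Lemma integrableDR f g : P.-integrable setT (EFin \o f) -> P.-integrable setT (EFin \o g) ->
  P.-integrable setT (EFin \o (fun w => f w + g w)).
Proof. by move=> fi gi; have := integrableD measurableT fi gi; exact: eq_integrable. Qed.

Lemma integrableZR (a : R) f : P.-integrable setT (EFin \o f) ->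
  P.-integrable setT (EFin \o (fun w => a * f w)).
Proof. by move=> fi; have := integrableZl measurableT a fi; exact: eq_integrable. Qed.

Lemma integrable_cstR (a : R) : P.-integrable setT (EFin \o (fun=> a)).
Proof. exact: finite_measure_integrable_cst. Qed.

Lemma integrable_sumR (I : Type) (s : seq I) (p : pred I) (F : I -> T -> R) :
  (forall i, p i -> P.-integrable setT (EFin \o F i)) ->
  P.-integrable setT (EFin \o (fun w => \sum_(i <- s | p i) F i w)).
Proof.
move=> iF; elim: s => [|i s IH].
  by under eq_fun do rewrite big_nil; exact: integrable_cstR.
have -> : (fun w => \sum_(l <- i :: s | p l) F l w) =
   (fun w => (if p i then F i w else 0) + \sum_(l <- s | p l) F l w).
  by apply/funext => w; rewrite big_cons; case: ifP => _ //; rewrite add0r.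
apply: integrableDR => //; case: (boolP (p i)) => [/iF //|_]; exact: integrable_cstR.
Qed.

Lemma Rintegral_sum (I : Type) (s : seq I) (p : pred I) (F : I -> T -> R) :
  (forall i, p i -> P.-integrable setT (EFin \o F i)) ->
  \int[P]_w (\sum_(i <- s | p i) F i w) = \sum_(i <- s | p i) \int[P]_w F i w.
Proof.
move=> iF; elim: s => [|i s IH].
  rewrite big_nil; under eq_Rintegral do rewrite big_nil.
  by rewrite Rintegral_cst// mul0r.
rewrite big_cons; under eq_Rintegral do rewrite big_cons.
case: (boolP (p i)) => // pi; rewrite RintegralD ?IH//; first exact: iF.
exact: integrable_sumR.
Qed.

Lemma Rintegral_cstP (a : R) : \int[P]_w a = a.
Proof.
transitivity (a * fine (P setT)); first exact: Rintegral_cst.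
by rewrite probability_setT mulr1.
Qed.

Lemma EFin_Rintegral f : P.-integrable setT (EFin \o f) ->
  ((\int[P]_w f w)%:E = \int[P]_w (f w)%:E)%E.
Proof. by move=> fi; rewrite /Rintegral fineK//; exact: integrable_fin_num. Qed.

Lemma L2v_sqn X : L2v X -> P.-integrable setT (EFin \o (fun w => sqn (X w))).
Proof.
move=> [mX X2]; apply: integrable_ge0 => //; first exact: measurable_sqn.
by move=> w; exact: sqn_ge0.
Qed.

Lemma L2v_dot X Y : L2v X -> L2v Y ->
  P.-integrable setT (EFin \o (fun w => dot (X w) (Y w))).
Proof.
move=> X2 Y2; apply: (@integrable_le _ (fun w => sqn (X w) + sqn (Y w))).
- by apply: measurable_dot; [case: X2|case: Y2].
- by move=> w; exact: dot_abs_le.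
- by apply: integrableDR; exact: L2v_sqn.
Qed.

Lemma L2v_le X f : vec_measurable X -> (forall w, sqn (X w) <= f w) ->
  P.-integrable setT (EFin \o f) -> L2v X.
Proof.
move=> mX Xf fi; split => //.
have : P.-integrable setT (EFin \o (fun w => sqn (X w))).
  apply: integrable_le fi; first exact: measurable_sqn.
  by move=> w; rewrite ger0_norm ?sqn_ge0.
by move=> /(integrable_fin_num measurableT); rewrite ltey_eq => ->.
Qed.

Lemma L2vD X Y : L2v X -> L2v Y -> L2v (fun w => X w + Y w).
Proof.
move=> X2 Y2; apply: (@L2v_le _ (fun w => 2 * sqn (X w) + 2 * sqn (Y w))).
- by apply: vec_measurableD; [case: X2|case: Y2].
- by move=> w; exact: sqnD_le.
- by apply: integrableDR; apply: integrableZR; exact: L2v_sqn.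
Qed.

Lemma L2vZ (a : R) X : L2v X -> L2v (fun w => a *: X w).
Proof.
move=> X2; apply: (@L2v_le _ (fun w => a ^+ 2 * sqn (X w))).
- by apply: vec_measurableZ; [exact: measurable_cst|case: X2].
- by move=> w; rewrite sqnZ.
- by apply: integrableZR; exact: L2v_sqn.
Qed.

Lemma L2vN X : L2v X -> L2v (fun w => - X w).
Proof. by move=> /(L2vZ (-1)); under eq_fun do rewrite scaleN1r. Qed.

Lemma L2vB X Y : L2v X -> L2v Y -> L2v (fun w => X w - Y w).
Proof. by move=> X2 /L2vN; exact: L2vD. Qed.

Lemma L2v_cst (u : 'rV[R]_d) : L2v (fun=> u).
Proof.
by apply: (@L2v_le _ (fun=> sqn u)) => //; exact: integrable_cstR.
Qed.

Lemma L2v_sum (I : Type) (s : seq I) (p : pred I) (F : I -> T -> 'rV[R]_d) :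
  (forall i, p i -> L2v (F i)) -> L2v (fun w => \sum_(i <- s | p i) F i w).
Proof.
move=> F2; elim: s => [|i s IH].
  by under eq_fun do rewrite big_nil; exact: L2v_cst.
under eq_fun do rewrite big_cons; case: (boolP (p i)) => // pi.
by apply: L2vD => //; exact: F2.
Qed.

Lemma Esqn_ge0 X : 0 <= Esqn X.
Proof. by apply: Rintegral_ge0 => w _; exact: sqn_ge0. Qed.

(** No means are subtracted: this is orthogonality in L2, which agrees with vanishing covariance as
    soon as one of the two vectors is centred. *)
Definition uncorrelated X Y := \int[P]_w dot (X w) (Y w) = 0.

Lemma uncorrelatedC X Y : uncorrelated X Y -> uncorrelated Y X.
Proof. by rewrite /uncorrelated; under eq_Rintegral do rewrite dotC. Qed.

Lemma uncorrelatedDl X Y Z : L2v X -> L2v Y -> L2v Z ->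
  uncorrelated X Z -> uncorrelated Y Z -> uncorrelated (fun w => X w + Y w) Z.
Proof.
move=> X2 Y2 Z2 XZ YZ; rewrite /uncorrelated; under eq_Rintegral do rewrite dotDl.
by rewrite RintegralD ?XZ ?YZ ?addr0//; exact: L2v_dot.
Qed.

Lemma uncorrelatedDr X Y Z : L2v X -> L2v Y -> L2v Z ->
  uncorrelated Z X -> uncorrelated Z Y -> uncorrelated Z (fun w => X w + Y w).
Proof.
by move=> *; apply: uncorrelatedC; apply: uncorrelatedDl => //; exact: uncorrelatedC.
Qed.

Lemma uncorrelatedZl (a : R) X Y : L2v X -> L2v Y -> uncorrelated X Y ->
  uncorrelated (fun w => a *: X w) Y.
Proof.
move=> X2 Y2 XY; rewrite /uncorrelated; under eq_Rintegral do rewrite dotZl.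
by rewrite RintegralZl ?XY ?mulr0//; exact: L2v_dot.
Qed.

Lemma uncorrelatedNl X Y : L2v X -> L2v Y -> uncorrelated X Y ->
  uncorrelated (fun w => - X w) Y.
Proof.
by move=> X2 Y2 /(uncorrelatedZl (-1) X2 Y2); under eq_fun do rewrite scaleN1r.
Qed.

Lemma uncorrelated_sumr (I : eqType) (s : seq I) (p : pred I) (F : I -> T -> 'rV[R]_d) Z :
  (forall i, p i -> L2v (F i)) -> L2v Z ->
  (forall i, i \in s -> p i -> uncorrelated Z (F i)) ->
  uncorrelated Z (fun w => \sum_(i <- s | p i) F i w).
Proof.
move=> F2 Z2 ZF; rewrite /uncorrelated.
under eq_Rintegral do rewrite dotC dot_suml.
rewrite Rintegral_sum => [|i pi]; last by apply: L2v_dot => //; exact: F2.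
by rewrite big_seq_cond big1// => i /andP[si pi]; exact/uncorrelatedC/ZF.
Qed.

Lemma EsqnD X Y : L2v X -> L2v Y -> uncorrelated X Y ->
  Esqn (fun w => X w + Y w) = Esqn X + Esqn Y.
Proof.
move=> X2 Y2 XY; rewrite /Esqn; under eq_Rintegral do rewrite sqnD.
have iX := L2v_sqn X2; have iY := L2v_sqn Y2; have iXY := L2v_dot X2 Y2.
have iXY2 := integrableZR 2 iXY.
rewrite RintegralD//; last exact: integrableDR.
by rewrite RintegralD// RintegralZl// XY mulr0 addr0.
Qed.

Lemma EsqnZ (a : R) X : L2v X -> Esqn (fun w => a *: X w) = a ^+ 2 * Esqn X.
Proof.
move=> X2; rewrite /Esqn; under eq_Rintegral do rewrite sqnZ.
by rewrite RintegralZl//; exact: L2v_sqn.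
Qed.

Lemma EsqnN X : Esqn (fun w => - X w) = Esqn X.
Proof. by apply: eq_Rintegral => w _; rewrite sqnN. Qed.

Lemma Esqn_sum (I : eqType) (s : seq I) (p : pred I) (F : I -> T -> 'rV[R]_d) :
  uniq s -> (forall i, p i -> L2v (F i)) ->
  (forall i l, p i -> p l -> i != l -> uncorrelated (F i) (F l)) ->
  Esqn (fun w => \sum_(i <- s | p i) F i w) = \sum_(i <- s | p i) Esqn (F i).
Proof.
move=> + F2 oF; elim: s => [_|i s IH /= /andP[si us]].
  rewrite big_nil /Esqn; under eq_Rintegral do rewrite big_nil sqn0.
  exact: Rintegral_cstP.
rewrite big_cons; under [in LHS]eq_fun do rewrite big_cons.
case: (boolP (p i)) => pi; last exact: IH.
rewrite EsqnD ?IH//; [exact: F2|exact: L2v_sum|].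
apply: uncorrelated_sumr => //; first exact: F2.
by move=> l ls pl; apply: oF => //; apply: contraNneq si => ->.
Qed.

End square_integrable.

(** * Independent sources *)

Section sources.
Context dO (Om : measurableType dO) (R : realType) (P : probability Om R).
Context (J : eqType) (F : J -> set (set Om)).
Hypothesis indF : mutually_independent P F.
Hypothesis sigF : forall j, sigma_algebra setT (F j).

(** All randomness except source [j]. Conditioning on it freezes everything but [j], so a variable
    measurable for [Rest j] acts as a constant when [j] is integrated out. *)
Definition rest (j : J) : set (set Om) := \bigcup_(i in [set i | i != j]) F i.

Local Notation Rest j := (g_sigma_algebraType (rest j)).

Definition source dV (V : measurableType dV) (j : J) (Y : Om -> V)
    (nu : probability V R) :=
  (forall C, measurable C -> F j (Y @^-1` C)) /\
  (forall C, measurable C -> P (Y @^-1` C) = nu C).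

Lemma rest_measurable j : rest j `<=` measurable.
Proof. by move=> A [i _]; exact: indF.1. Qed.

Lemma measurable_fun_rest dV (V : measurableType dV) j (f : Om -> V) :
  measurable_fun setT (f : Rest j -> V) -> measurable_fun setT f.
Proof.
move=> mf.
exact: (measurableT_comp mf (measurable_to_sub (@rest_measurable j))).
Qed.

Lemma vec_measurable_rest d j (X : Om -> 'rV[R]_d) :
  @vec_measurable R d _ (Rest j) X -> vec_measurable X.
Proof. by move=> mX k; apply: measurable_fun_rest (mX k). Qed.

Context dV (V : measurableType dV).
Implicit Types (Y : Om -> V) (nu : probability V R).

Lemma measurable_source_rest i j Y nu : i != j -> source i Y nu ->
  measurable_fun setT (Y : Rest j -> V).
Proof.
move=> ij [sY _] _ C mC; rewrite setTI.
by apply: sub_sigma_algebra; exists i => //; exact: sY.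
Qed.

Lemma measurable_source j Y nu : source j Y nu -> measurable_fun setT Y.
Proof. by move=> [sY _] _ C mC; rewrite setTI; exact: indF.1 (sY _ mC). Qed.

Lemma source_indep j Y nu : source j Y nu -> forall A C,
  <<s rest j >> A -> measurable C -> P (A `&` Y @^-1` C) = (P A * nu C)%E.
Proof.
move=> [sY lY] A C sA mC; rewrite -lY//.
by apply: (mutually_independent_rest indF sigF sA); exact: sY.
Qed.

(** The source may be replaced by a fresh draw from its law, since the first argument of [h] is seen
    through [Rest j] only. *)
Lemma source_fubini j Y nu (h : Om -> V -> R) : source j Y nu ->
  measurable_fun setT (fun z : Rest j * V => h z.1 z.2) ->
  (forall w u, 0 <= h w u) ->
  (\int[P]_w (h w (Y w))%:E = \int[P]_w \int[nu]_u (h w u)%:E)%E.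
Proof.
move=> sY mh h0.
have mY := measurable_source sY.
apply: (indep_fubini_ge0 (@rest_measurable j) mY (source_indep sY)
  (h := fun z => (h z.1 z.2)%:E)); first exact/measurable_EFinP.
by move=> z; rewrite lee_fin.
Qed.

(** With every source but [j] frozen, [Z] is constant and [h] averages to zero over [j]. *)
Lemma source_uncorrelated d j Y nu (h : Om -> V -> 'rV[R]_d) (Z : Om -> 'rV[R]_d) :
  source j Y nu ->
  (forall k, measurable_fun setT (fun z : Rest j * V => h z.1 z.2 0 k)) ->
  (forall w k, nu.-integrable setT (fun u => (h w u 0 k)%:E) /\
     (\int[nu]_u (h w u 0 k)%:E = 0)%E) ->
  @vec_measurable R d _ (Rest j) Z -> L2v P Z -> L2v P (fun w => h w (Y w)) ->
  uncorrelated P (fun w => h w (Y w)) Z.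
Proof.
move=> sY mh h0 mZ Z2 hY2; apply: uncorrelatedC; rewrite /uncorrelated /Rintegral.
rewrite (indep_mean0 (@rest_measurable j) (measurable_source sY) (source_indep sY)
  (h := fun z => dot (Z z.1) (h z.1 z.2)))//.
- apply: measurable_sum => k; apply: measurable_funM; last exact: mh.
  exact: (measurableT_comp (mZ k)).
- move=> w /=; rewrite /dot.
  have iZ k : nu.-integrable setT (EFin \o (fun u => Z w 0 k * h w u 0 k)).
    by apply: integrableZR; case: (h0 w k).
  rewrite -(EFin_Rintegral (integrable_sumR _ _))// Rintegral_sum//.
  rewrite big1// => k _; rewrite RintegralZl//; last by case: (h0 w k).
  by rewrite /Rintegral (h0 w k).2 mulr0.
- exact: L2v_dot.
Qed.

End sources.

(** * Variance of one communication round *)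

Section one_round.
Context dO (Om : measurableType dO) (R : realType) (P : probability Om R).
Context (J : eqType) (F : J -> set (set Om)).
Hypothesis indF : mutually_independent P F.
Hypothesis sigF : forall j, sigma_algebra setT (F j).
Local Notation Rest j := (g_sigma_algebraType (rest F j)).

Context (d : nat) (W : finType) (good : {set W}).
Context dS (S : measurableType dS) (nuS : W -> probability S R).
Context (Dhat : W -> 'rV[R]_d -> 'rV[R]_d -> S -> 'rV[R]_d).
Context dU (U : measurableType dU) (nuU : probability U R).
Context (Q : 'rV[R]_d -> U -> 'rV[R]_d) (omega C : R).
Context (jc : J) (jx je : W -> J).
Hypothesis jcx : forall i, jc != jx i.
Hypothesis jce : forall i, jc != je i.
Hypothesis jxe : forall i l, jx i != je l.
Hypothesis jxI : injective jx.
Hypothesis jeI : injective je.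
Context (chi : Om -> bool) (xi : W -> Om -> S) (eta : W -> Om -> U).
Hypothesis chiF : forall D : set bool, F jc (chi @^-1` D).
Hypothesis xiF : forall i, i \in good -> source P F (jx i) (xi i) (nuS i).
Hypothesis etaF : forall i, i \in good -> source P F (je i) (eta i) nuU.
Context (y z : Om -> 'rV[R]_d) (Dl : W -> Om -> 'rV[R]_d).

(** The current randomness is the coin [jc] and the seeds [jx i], [je i];
    [X] belongs to the past when it can be computed without any one of them. *)
Definition past_measurable (X : Om -> 'rV[R]_d) :=
  forall j, (j = jc \/ exists2 i, i \in good & j = jx i \/ j = je i) ->
  @vec_measurable R d _ (Rest j) X.

Hypothesis my : past_measurable y.
Hypothesis mz : past_measurable z.
Hypothesis mDl : forall i, i \in good -> past_measurable (Dl i).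
Hypothesis Dl2 : forall i, i \in good -> L2v P (Dl i).
Hypothesis yz2 : L2v P (fun w => y w - z w).
Hypothesis omega0 : 0 <= omega.
Hypothesis C0 : 0 <= C.
Hypothesis mDhat : forall i, i \in good -> forall k : 'I_d,
  measurable_fun setT
    (fun t : (vecM R d * vecM R d * S)%type => Dhat i t.1.1 t.1.2 t.2 0 k).
Hypothesis Dhat_mean : forall i, i \in good -> forall w (k : 'I_d),
  (nuS i).-integrable setT (fun s => (Dhat i (y w) (z w) s 0 k)%:E) /\
  (\int[nuS i]_s (Dhat i (y w) (z w) s 0 k)%:E = (Dl i w 0 k)%:E)%E.
Hypothesis Dhat_var : forall w,
  (\sum_(i in good) \int[nuS i]_s (sqn (Dhat i (y w) (z w) s - Dl i w))%:E
     <= (C * sqn (y w - z w))%:E)%E.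
Hypothesis mQ : forall k : 'I_d,
  measurable_fun setT (fun t : (vecM R d * U)%type => Q t.1 t.2 0 k).
Hypothesis Q_mean : forall (v : 'rV[R]_d) (k : 'I_d),
  nuU.-integrable setT (fun u => (Q v u 0 k)%:E) /\
  (\int[nuU]_u (Q v u 0 k)%:E = (v 0 k)%:E)%E.
Hypothesis Q_var : forall v : 'rV[R]_d,
  (\int[nuU]_u (sqn (Q v u - v))%:E <= (omega * sqn v)%:E)%E.

Let x_ w : R := (chi w)%:R.
Let q : R := \int[P]_w x_ w.
Let Dh i w : 'rV[R]_d := Dhat i (y w) (z w) (xi i w).
Let Qv i w : 'rV[R]_d := Q (Dh i w) (eta i w).
(* compression noise [a] and sampling noise [b], both switched off when the
   estimators are not used *)
Let a i w : 'rV[R]_d := x_ w *: (Qv i w - Dh i w).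
Let b i w : 'rV[R]_d := x_ w *: (Dh i w - Dl i w).
Let nz i w : 'rV[R]_d := a i w + b i w.

Let x_sqr w : x_ w ^+ 2 = x_ w.
Proof. by rewrite /x_; case: (chi w); rewrite ?expr1n ?expr0n. Qed.

Let x_ge0 w : 0 <= x_ w.
Proof. exact: ler0n. Qed.

Let mbool : measurable_fun setT (fun u : bool => (u%:R : R)).
Proof. by []. Qed.

Let mx j : jc != j -> measurable_fun setT (x_ : Rest j -> R).
Proof.
move=> jcj; rewrite /x_; apply: (measurableT_comp mbool).
by move=> _ D _; rewrite setTI; apply: sub_sigma_algebra; exists jc.
Qed.

Let mxO : measurable_fun setT x_.
Proof.
apply: (measurableT_comp mbool) => _ D _; rewrite setTI; exact: indF.1 (chiF D).
Qed.

Let past_measurableO X : past_measurable X -> vec_measurable X.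
Proof. by move=> pX; apply: (vec_measurable_rest indF (j := jc)); apply: pX; left. Qed.

Let L2v_x (X : Om -> 'rV[R]_d) : L2v P X -> L2v P (fun w => x_ w *: X w).
Proof.
move=> X2; apply: (@L2v_le _ _ _ _ _ _ (fun w => sqn (X w))); last exact: L2v_sqn.
  by apply: vec_measurableZ => //; case: X2.
move=> w; rewrite sqnZ x_sqr ler_piMl ?sqn_ge0// /x_; by case: (chi w).
Qed.

(** The coin is itself a source: [h] is computed without it, so integrating the coin first replaces
    [x_] by its mean [q]. *)
Let coin_ge0 (h : Om -> R) : measurable_fun setT (h : Rest jc -> R) ->
  (forall w, 0 <= h w) -> P.-integrable setT (EFin \o h) ->
  (\int[P]_w (x_ w * h w)%:E = (q * \int[P]_w h w)%:E)%E.
Proof.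
move=> mh h0 ih.
have mchi : measurable_fun setT chi.
  by move=> _ D _; rewrite setTI; exact: indF.1 (chiF D).
pose chi' : {mfun Om >-> bool} := HB.pack chi (isMeasurableFun.Build _ _ _ _ chi mchi).
have schi : source P F jc chi (distribution P chi') by split.
rewrite (@source_fubini _ _ _ _ _ _ indF sigF _ _ _ _ _ (fun w (u : bool) => u%:R * h w) schi).
- have qE : (\int[distribution P chi']_u ((u : bool)%:R : R)%:E = q%:E)%E.
    rewrite ge0_integral_pushforward//.
    rewrite EFin_Rintegral//; apply: (@integrable_le _ _ _ _ _ (fun=> 1)) => //; last exact: integrable_cstR.
    by move=> w; rewrite ger0_norm// /x_; case: (chi w).
  transitivity (\int[P]_w (q%:E * (h w)%:E))%E.
    apply: eq_integral => w _; under eq_integral do rewrite EFinM muleC.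
    by rewrite ge0_integralZl ?qE ?lee_fin// 1?muleC//.
  by rewrite EFinM (EFin_Rintegral ih); exact: (integralZl measurableT ih q).
- apply: measurable_funM; last exact: (measurableT_comp mh).
  exact: (measurableT_comp mbool).
- by move=> w u; apply: mulr_ge0.
Qed.

Lemma Esqn_coin X : past_measurable X -> L2v P X ->
  Esqn P (fun w => x_ w *: X w) = q * Esqn P X.
Proof.
move=> pX X2; apply: EFin_inj; rewrite -coin_ge0.
- rewrite EFin_Rintegral; last exact: L2v_sqn (L2v_x X2).
  by apply: eq_integral => w _; rewrite sqnZ x_sqr.
- by apply: measurable_sqn; apply: pX; left.
- by move=> w; exact: sqn_ge0.
- exact: L2v_sqn.
Qed.

Let cur_x i : i \in good -> jx i = jc \/ exists2 l, l \in good & jx i = jx l \/ jx i = je l.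
Proof. by move=> gi; right; exists i => //; left. Qed.

Let cur_e i : i \in good -> je i = jc \/ exists2 l, l \in good & je i = jx l \/ je i = je l.
Proof. by move=> gi; right; exists i => //; right. Qed.

(** [Dh i] involves the past and the seed [jx i] only, hence can be computed without any other
    current source. *)
Let mDh j i : i \in good ->
  (j = jc \/ exists2 l, l \in good & j = jx l \/ j = je l) ->
  jx i != j -> @vec_measurable R d _ (Rest j) (Dh i).
Proof.
move=> gi cj ij k.
have mp : measurable_fun setT
    (fun w : Rest j => ((y w : vecM R d, z w : vecM R d), xi i w)).
  apply: measurable_fun_pair; last exact: measurable_source_rest ij (xiF gi).
  by apply: measurable_fun_pair; apply/vec_measurable_vecM; [exact: my|exact: mz].
exact: (measurableT_comp (mDhat gi k) mp).
Qed.

Let mQv j i : i \in good ->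
  (j = jc \/ exists2 l, l \in good & j = jx l \/ j = je l) ->
  jx i != j -> je i != j -> @vec_measurable R d _ (Rest j) (Qv i).
Proof.
move=> gi cj ij ij' k.
have mp : measurable_fun setT (fun w : Rest j => (Dh i w : vecM R d, eta i w)).
  apply: measurable_fun_pair; last exact: measurable_source_rest ij' (etaF gi).
  by apply/vec_measurable_vecM; exact: mDh.
exact: (measurableT_comp (mQ k) mp).
Qed.

Let mb j i : i \in good ->
  (j = jc \/ exists2 l, l \in good & j = jx l \/ j = je l) ->
  jc != j -> jx i != j -> @vec_measurable R d _ (Rest j) (b i).
Proof.
move=> gi cj cj' ij; apply: vec_measurableZ; first exact: mx.
by apply: vec_measurableB; [exact: mDh|exact: mDl].
Qed.

Let ma j i : i \in good ->
  (j = jc \/ exists2 l, l \in good & j = jx l \/ j = je l) ->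
  jc != j -> jx i != j -> je i != j -> @vec_measurable R d _ (Rest j) (a i).
Proof.
move=> gi cj cj' ij ij'; apply: vec_measurableZ; first exact: mx.
by apply: vec_measurableB; [exact: mQv|exact: mDh].
Qed.

Let mDhO i : i \in good -> vec_measurable (Dh i).
Proof.
move=> gi; apply: (vec_measurable_rest indF (j := jc)); apply: mDh => //; first by left.
by rewrite eq_sym.
Qed.

Let mQvO i : i \in good -> vec_measurable (Qv i).
Proof.
move=> gi; apply: (vec_measurable_rest indF (j := jc)); apply: mQv => //; first by left.
  by rewrite eq_sym.
by rewrite eq_sym.
Qed.

Let mbO i : i \in good -> vec_measurable (b i).
Proof.
move=> gi; apply: vec_measurableZ => //.
by apply: vec_measurableB; [exact: mDhO|apply: past_measurableO; exact: mDl].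
Qed.

Let maO i : i \in good -> vec_measurable (a i).
Proof.
move=> gi; apply: vec_measurableZ => //.
by apply: vec_measurableB; [exact: mQvO|exact: mDhO].
Qed.

Let hb i w s : 'rV[R]_d := x_ w *: (Dhat i (y w) (z w) s - Dl i w).

Let mhb i k : i \in good ->
  measurable_fun setT (fun t : Rest (jx i) * S => hb i t.1 t.2 0 k).
Proof.
move=> gi; rewrite /hb; under eq_fun do rewrite !mxE.
apply: measurable_funM.
  by apply: (measurableT_comp (mx _)) => //; exact: jcx.
apply: measurable_funB.
  have vy : measurable_fun setT (y : Rest (jx i) -> vecM R d).
    by apply/vec_measurable_vecM; apply: my; exact: cur_x.
  have vz : measurable_fun setT (z : Rest (jx i) -> vecM R d).
    by apply/vec_measurable_vecM; apply: mz; exact: cur_x.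
  have mp : measurable_fun setT (fun t : Rest (jx i) * S =>
      ((y t.1 : vecM R d, z t.1 : vecM R d), t.2)).
    apply: measurable_fun_pair => //; apply: measurable_fun_pair.
      exact: (measurableT_comp vy).
    exact: (measurableT_comp vz).
  exact: (measurableT_comp (mDhat gi k) mp).
by apply: (measurableT_comp (mDl gi (cur_x gi) k)).
Qed.

Let ha i w u : 'rV[R]_d := x_ w *: (Q (Dh i w) u - Dh i w).

Let mha i k : i \in good ->
  measurable_fun setT (fun t : Rest (je i) * U => ha i t.1 t.2 0 k).
Proof.
move=> gi; rewrite /ha; under eq_fun do rewrite !mxE.
have mD : @vec_measurable R d _ (Rest (je i)) (Dh i).
  by apply: mDh => //; exact: cur_e.
apply: measurable_funM.
  by apply: (measurableT_comp (mx _)) => //; exact: jce.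
apply: measurable_funB; last exact: (measurableT_comp (mD k)).
have vD : measurable_fun setT (Dh i : Rest (je i) -> vecM R d).
  exact/vec_measurable_vecM.
have mp : measurable_fun setT (fun t : Rest (je i) * U => (Dh i t.1 : vecM R d, t.2)).
  by apply: measurable_fun_pair => //; exact: (measurableT_comp vD).
exact: (measurableT_comp (mQ k) mp).
Qed.

(** Only the sum over workers is bounded, because (A4) is an average over them. The inequality is
    between extended reals since square integrability of each [b i] is not yet known; it is deduced
    from this bound. *)
Let sum_b_le :
  (\sum_(i in good) \int[P]_w (sqn (b i w))%:E
    <= (q * (C * Esqn P (fun w => y w - z w)))%:E)%E.
Proof.
have mG i : i \in good -> measurable_fun setT
    (fun w => \int[nuS i]_s (sqn (hb i w s))%:E)%E.
  move=> gi; apply: (@measurable_fun_rest _ _ _ _ _ _ indF _ _ (jx i)).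
  apply: (measurable_fun_fubini_tonelli_F (m2 := nuS i)
    (fun t : Rest (jx i) * S => (sqn (hb i t.1 t.2))%:E)).
    by apply/measurable_EFinP; apply: measurable_sqn => k; exact: mhb.
  by move=> t; rewrite lee_fin sqn_ge0.
have -> : (\sum_(i in good) \int[P]_w (sqn (b i w))%:E =
    \int[P]_w \sum_(i in good) \int[nuS i]_s (sqn (hb i w s))%:E)%E.
  transitivity (\sum_i \int[P]_w (if i \in good then
      \int[nuS i]_s (sqn (hb i w s))%:E else 0))%E.
    rewrite big_mkcond /=; apply: eq_bigr => i _; case: ifP => gi; last by rewrite integral0.
    apply: (source_fubini indF sigF (h := fun w s => sqn (hb i w s)) (xiF gi)).
      by apply: measurable_sqn => k; exact: mhb.
    by move=> w s; exact: sqn_ge0.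
  rewrite -ge0_integral_sum//.
  - by apply: eq_integral => w _; rewrite [RHS]big_mkcond.
  - by move=> i; case: (boolP (i \in good)) => // gi; exact: mG.
  - move=> i w _; case: ifP => // _; apply: integral_ge0 => s _.
    by rewrite lee_fin sqn_ge0.
have iyz := integrableZR C (L2v_sqn yz2).
rewrite [X in (_ <= (q * X)%:E)%E](_ : _ = \int[P]_w (C * sqn (y w - z w))); last first.
  by rewrite RintegralZl//; exact: L2v_sqn.
rewrite -coin_ge0//; first last.
- by move=> w; apply: mulr_ge0 => //; exact: sqn_ge0.
- apply: measurable_funM => //; apply: measurable_sqn; apply: vec_measurableB.
    by apply: my; left.
  by apply: mz; left.
apply: ge0_le_integral => //.
- move=> w _; apply: sume_ge0 => i _; apply: integral_ge0 => s _.
  by rewrite lee_fin sqn_ge0.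
- under eq_fun do rewrite big_mkcond; apply: emeasurable_sum => i.
  by case: (boolP (i \in good)) => // gi; exact: mG.
- apply/measurable_EFinP; apply: measurable_funM => //; apply: measurable_funM => //.
  by apply: measurable_sqn; case: yz2.
- move=> w _; rewrite /hb /x_; case: (chi w) => /=; last first.
    rewrite mul0r big1// => i _; under eq_integral do rewrite scale0r sqn0.
    exact: integral0.
  rewrite mul1r; apply: le_trans (Dhat_var w); rewrite le_eqVlt; apply/orP; left.
  by apply/eqP; apply: eq_bigr => i _; apply: eq_integral => s _; rewrite scale1r.
Qed.

Let b2 i : i \in good -> L2v P (b i).
Proof.
move=> gi; split; first exact: mbO.
apply: le_lt_trans (ltry (q * (C * Esqn P (fun w => y w - z w)))).
apply: le_trans sum_b_le; rewrite (bigD1 i)//= leeDl//.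
by apply: sume_ge0 => l _; apply: integral_ge0 => w _; rewrite lee_fin sqn_ge0.
Qed.

Let EFin_Esqn (X : Om -> 'rV[R]_d) : L2v P X ->
  (\int[P]_w (sqn (X w))%:E = (Esqn P X)%:E)%E.
Proof. by move=> X2; rewrite EFin_Rintegral//; exact: L2v_sqn. Qed.

Let sum_b : \sum_(i in good) Esqn P (b i) <= q * (C * Esqn P (fun w => y w - z w)).
Proof.
rewrite -lee_fin; apply: le_trans sum_b_le.
rewrite -sumEFin le_eqVlt; apply/orP; left; apply/eqP.
by apply: eq_bigr => i gi; rewrite EFin_Esqn//; exact: b2.
Qed.

Let xDh i w : x_ w *: Dh i w = x_ w *: Dl i w + b i w.
Proof. by rewrite /b -scalerDr addrC subrK. Qed.

Let xDh2 i : i \in good -> L2v P (fun w => x_ w *: Dh i w).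
Proof.
move=> gi; under eq_fun do rewrite xDh.
by apply: L2vD; [exact/L2v_x/Dl2|exact: b2].
Qed.

(** Given everything but the compression seed of worker [i], the input [Dh i] is fixed and the
    variance bound of the compressor applies. As for [b], the extended-real form comes first and
    yields integrability. *)
Let a_le i : i \in good ->
  (\int[P]_w (sqn (a i w))%:E <= (omega * Esqn P (fun w => x_ w *: Dh i w))%:E)%E.
Proof.
move=> gi.
have mhai : measurable_fun setT (fun t : Rest (je i) * U => sqn (ha i t.1 t.2)).
  by apply: measurable_sqn => k; exact: mha.
have -> : (\int[P]_w (sqn (a i w))%:E = \int[P]_w \int[nuU]_u (sqn (ha i w u))%:E)%E.
  apply: (source_fubini indF sigF (h := fun w s => sqn (ha i w s)) (etaF gi)) => //.
  by move=> w s; exact: sqn_ge0.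
have iD := integrableZR omega (L2v_sqn (xDh2 gi)).
have -> : omega * Esqn P (fun w => x_ w *: Dh i w) =
    \int[P]_w (omega * sqn (x_ w *: Dh i w)).
  by rewrite RintegralZl//; exact: L2v_sqn (xDh2 gi).
rewrite EFin_Rintegral//; apply: ge0_le_integral => //.
- by move=> w _; apply: integral_ge0 => s _; rewrite lee_fin sqn_ge0.
- apply: (@measurable_fun_rest _ _ _ _ _ _ indF _ _ (je i)).
  apply: (measurable_fun_fubini_tonelli_F (m2 := nuU)
    (fun t : Rest (je i) * U => (sqn (ha i t.1 t.2))%:E)); first exact/measurable_EFinP.
  by move=> t; rewrite lee_fin sqn_ge0.
- by case/integrableP: iD.
- move=> w _; rewrite /ha /x_; case: (chi w) => /=; last first.
    under eq_integral do rewrite scale0r sqn0.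
    by rewrite integral0 scale0r sqn0 mulr0.
  rewrite scale1r; apply: le_trans (Q_var (Dh i w)); rewrite le_eqVlt; apply/orP; left.
  by apply/eqP; apply: eq_integral => s _; rewrite scale1r.
Qed.

Let a2 i : i \in good -> L2v P (a i).
Proof.
move=> gi; split; first exact: maO.
exact: le_lt_trans (a_le gi) (ltry _).
Qed.

Let Esqn_a i : i \in good ->
  Esqn P (a i) <= omega * Esqn P (fun w => x_ w *: Dh i w).
Proof. by move=> gi; rewrite -lee_fin -EFin_Esqn ?a_le//; exact: a2. Qed.

Let a_uncorr i (Z : Om -> 'rV[R]_d) : i \in good ->
  @vec_measurable R d _ (Rest (je i)) Z -> L2v P Z -> uncorrelated P (a i) Z.
Proof.
move=> gi mZ Z2.
apply: (source_uncorrelated indF sigF (h := ha i) (etaF gi)) => //.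
- by move=> k; exact: mha.
- move=> w k; have [iQ EQ] := Q_mean (Dh i w) k.
  have iQD : nuU.-integrable setT (EFin \o (fun u => Q (Dh i w) u 0 k - Dh i w 0 k)).
    by apply: integrableDR => //; exact: integrable_cstR.
  have haE : (fun u => (ha i w u 0 k)%:E) =
      (EFin \o (fun u => x_ w * (Q (Dh i w) u 0 k - Dh i w 0 k))).
    by apply/funext => u; rewrite /ha !mxE.
  rewrite haE; split; first exact: integrableZR.
  rewrite -EFin_Rintegral; last exact: integrableZR.
  rewrite RintegralZl// RintegralB//; last exact: integrable_cstR.
  by rewrite {1}/Rintegral EQ /= Rintegral_cstP subrr mulr0.
- exact: a2.
Qed.

Let b_uncorr i (Z : Om -> 'rV[R]_d) : i \in good ->
  @vec_measurable R d _ (Rest (jx i)) Z -> L2v P Z -> uncorrelated P (b i) Z.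
Proof.
move=> gi mZ Z2.
apply: (source_uncorrelated indF sigF (h := hb i) (xiF gi)) => //.
- by move=> k; exact: mhb.
- move=> w k; have [iQ EQ] := Dhat_mean gi w k.
  have iQD : (nuS i).-integrable setT
      (EFin \o (fun s => Dhat i (y w) (z w) s 0 k - Dl i w 0 k)).
    by apply: integrableDR => //; exact: integrable_cstR.
  have hbE : (fun s => (hb i w s 0 k)%:E) =
      (EFin \o (fun s => x_ w * (Dhat i (y w) (z w) s 0 k - Dl i w 0 k))).
    by apply/funext => s; rewrite /hb !mxE.
  rewrite hbE; split; first exact: integrableZR.
  rewrite -EFin_Rintegral; last exact: integrableZR.
  rewrite RintegralZl// RintegralB//; last exact: integrable_cstR.
  by rewrite {1}/Rintegral EQ /= Rintegral_cstP subrr mulr0.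
- exact: b2.
Qed.

Let nz2 i : i \in good -> L2v P (nz i).
Proof. by move=> gi; apply: L2vD; [exact: a2|exact: b2]. Qed.

Let nz_past i X : i \in good -> past_measurable X -> L2v P X ->
  uncorrelated P (nz i) (fun w => x_ w *: X w).
Proof.
move=> gi pX X2; apply: uncorrelatedDl; [exact: a2|exact: b2|exact: L2v_x| |].
- apply: a_uncorr => //; last exact: L2v_x.
  by apply: vec_measurableZ; [apply: mx; exact: jce|apply: pX; exact: cur_e].
- apply: b_uncorr => //; last exact: L2v_x.
  by apply: vec_measurableZ; [apply: mx; exact: jcx|apply: pX; exact: cur_x].
Qed.

(** Sampling noise involves no compression seed, so it is frozen when [je i] is integrated out; this
    includes the case [i = l]. *)
Let ab_uncorr i l : i \in good -> l \in good -> uncorrelated P (a i) (b l).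
Proof.
by move=> gi gl; apply: a_uncorr => //; [apply: mb => //; exact: cur_e|exact: b2].
Qed.

(** Of the four cross terms, the mixed ones vanish by [ab_uncorr], and the other two because
    distinct workers have distinct seeds. *)
Let nz_uncorr i l : i \in good -> l \in good -> i != l ->
  uncorrelated P (nz i) (nz l).
Proof.
move=> gi gl il.
have xx : jx l != jx i by rewrite (inj_eq jxI) eq_sym.
have ee : je l != je i by rewrite (inj_eq jeI) eq_sym.
have ai2 := a2 gi; have bi2 := b2 gi; have al2 := a2 gl; have bl2 := b2 gl.
apply: uncorrelatedDl => //; first exact: nz2.
  apply: uncorrelatedDr => //; last exact: ab_uncorr.
  by apply: a_uncorr => //; apply: ma => //; exact: cur_e.
apply: uncorrelatedDr => //; first exact/uncorrelatedC/ab_uncorr.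
by apply: b_uncorr => //; apply: mb => //; exact: cur_x.
Qed.

Let round_noise i := Esqn P (nz i).

(** Sampling noise counts twice: directly through [b i], and through the compressor, whose error is
    proportional to the second moment of its input [Dl i + b i]. This is the origin of the factor
    [1 + omega]. *)
Let sum_round_noise : \sum_(i in good) round_noise i <=
  q * (omega * (\sum_(i in good) Esqn P (Dl i))
       + (1 + omega) * (C * Esqn P (fun w => y w - z w))).
Proof.
have nE i : i \in good ->
    round_noise i <= omega * (q * Esqn P (Dl i)) + (1 + omega) * Esqn P (b i).
  move=> gi; rewrite /round_noise EsqnD; [|exact: a2|exact: b2|exact: ab_uncorr].
  have -> : omega * (q * Esqn P (Dl i)) + (1 + omega) * Esqn P (b i) =
    omega * (q * Esqn P (Dl i) + Esqn P (b i)) + Esqn P (b i) by ring.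
  rewrite lerD2r; apply: le_trans (Esqn_a gi) _; rewrite ler_wpM2l//.
  under eq_fun do rewrite xDh.
  have xD2 : L2v P (fun w => x_ w *: Dl i w) by apply: L2v_x; exact: Dl2.
  have -> : Esqn P (fun w => x_ w *: Dl i w + b i w) = q * Esqn P (Dl i) + Esqn P (b i).
    rewrite -Esqn_coin; [|exact: mDl|exact: Dl2].
    apply: EsqnD => //; first exact: b2.
    apply: uncorrelatedC; apply: b_uncorr => //.
    by apply: vec_measurableZ; [apply: mx; exact: jcx|apply: mDl => //; exact: cur_x].
  by [].
apply: le_trans (ler_sum _ nE) _.
rewrite big_split /= -!mulr_sumr.
have -> : q * (omega * (\sum_(i in good) Esqn P (Dl i)) +
    (1 + omega) * (C * Esqn P (fun w => y w - z w))) =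
  omega * (q * \sum_(i in good) Esqn P (Dl i)) +
    (1 + omega) * (q * (C * Esqn P (fun w => y w - z w))) by ring.
by rewrite lerD2l ler_wpM2l ?addr_ge0.
Qed.

Let round_mean e (s : R) : past_measurable e -> L2v P e ->
  Esqn P (fun w => x_ w *: (e w + s *: \sum_(i in good) (Qv i w - Dl i w)))
    = q * Esqn P e + s ^+ 2 * \sum_(i in good) round_noise i.
Proof.
move=> pe e2.
have -> : (fun w => x_ w *: (e w + s *: \sum_(i in good) (Qv i w - Dl i w))) =
    (fun w => x_ w *: e w + s *: \sum_(i in good) nz i w).
  apply/funext => w; rewrite scalerDr scalerA mulrC -scalerA scaler_sumr.
  congr (_ + s *: _); apply: eq_bigr => i _; rewrite /nz /a /b -scalerDr.
  by rewrite addrA subrK.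
have n2 : L2v P (fun w => \sum_(i in good) nz i w) by apply: L2v_sum; exact: nz2.
rewrite EsqnD; [|exact: L2v_x|exact: L2vZ|].
  rewrite Esqn_coin// EsqnZ//; congr (_ + _ * _).
  by apply: Esqn_sum; [exact: index_enum_uniq|exact: nz2|exact: nz_uncorr].
apply: uncorrelatedC; apply: uncorrelatedZl => //; first exact: L2v_x.
apply: uncorrelatedC; apply: uncorrelated_sumr; [exact: nz2|exact: L2v_x|].
by move=> i _ gi; apply: uncorrelatedC; exact: nz_past.
Qed.

(** An equality for distinct workers. For [i = l] the left side is 0, whereas [nz i] is not
    orthogonal to itself, so only the bound holds uniformly. *)
Let round_pair i l : i \in good -> l \in good ->
  Esqn P (fun w => x_ w *: (Qv i w - Qv l w)) <=
    q * Esqn P (fun w => Dl i w - Dl l w) + (round_noise i + round_noise l).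
Proof.
move=> gi gl.
have D2 : L2v P (fun w => Dl i w - Dl l w) by apply: L2vB; exact: Dl2.
have pD : past_measurable (fun w => Dl i w - Dl l w).
  by move=> j cj; apply: vec_measurableB; exact: mDl.
rewrite -Esqn_coin//.
have [<-|il] := eqVneq i l.
  rewrite [X in X <= _](_ : _ = 0) ?addr_ge0 ?Esqn_ge0//.
  rewrite /Esqn; under eq_Rintegral do rewrite subrr scaler0 sqn0.
  exact: Rintegral_cstP.
have -> : (fun w => x_ w *: (Qv i w - Qv l w)) =
    (fun w => x_ w *: (Dl i w - Dl l w) + (nz i w - nz l w)).
  apply/funext => w; rewrite /nz /a /b -!scalerDr -scalerBr -scalerDr; congr (_ *: _).
  by apply/rowP => k; rewrite !mxE; ring.
have ni := nz2 gi; have nl := nz2 gl; have nln := L2vN nl.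
have nu : uncorrelated P (nz i) (fun w => - nz l w).
  by apply: uncorrelatedC; apply: uncorrelatedNl => //; apply: nz_uncorr => //; rewrite eq_sym.
rewrite EsqnD; [|exact: L2v_x|exact: L2vD|].
  by rewrite EsqnD// EsqnN.
apply: uncorrelatedC; apply: uncorrelatedDl => //; first exact: L2v_x.
  exact: nz_past.
apply: uncorrelatedNl => //; first exact: L2v_x.
exact: nz_past.
Qed.

(** A single noise level [N i] per worker serves both the mean of the messages and their pairwise
    distances. The levels stay abstract because only their sum is controlled. *)
Lemma round_variance : exists N : W -> R,
  [/\ \sum_(i in good) N i <= q * (omega * (\sum_(i in good) Esqn P (Dl i))
          + (1 + omega) * (C * Esqn P (fun w => y w - z w))),
      (forall e s, past_measurable e -> L2v P e ->
        Esqn P (fun w => x_ w *: (e w + s *: \sum_(i in good) (Qv i w - Dl i w)))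
          = q * Esqn P e + s ^+ 2 * \sum_(i in good) N i),
      (forall i l, i \in good -> l \in good ->
        Esqn P (fun w => x_ w *: (Qv i w - Qv l w)) <=
          q * Esqn P (fun w => Dl i w - Dl l w) + (N i + N l)) &
      (forall i, i \in good -> L2v P (fun w => x_ w *: Qv i w))].
Proof.
exists round_noise; split; [exact: sum_round_noise|exact: round_mean|exact: round_pair|].
move=> i gi.
have -> : (fun w => x_ w *: Qv i w) = (fun w => x_ w *: Dl i w + nz i w).
  by apply/funext => w; apply/rowP => k; rewrite /nz /a /b !mxE; ring.
by apply: L2vD; [exact/L2v_x/Dl2|exact: nz2].
Qed.

End one_round.

(** * Rate of the Lyapunov recursion *)

Section rates.
Context (R : realType) (p beta B zeta mu gamma L A : R).
Hypotheses (p0 : 0 < p) (p1 : p <= 1) (beta0 : 0 <= beta) (B0 : 0 <= B).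

(** The deterministic core. [e] and [e'] are successive mean squared errors of [g]; [M1] is the
    error of the mean of the good messages and [M2] the aggregation error; [N], [N'] are mean
    squared gradients and [D] the mean squared step; [S1], [S2] are the pair sums for coin 1 and
    coin 0; [SN] is the total noise. *)
Lemma variance_recursion (G omega lb Lpm e e' M1 M2 N N' D S1 S2 SN : R) :
  2 <= G -> 0 <= omega -> 0 <= lb -> 0 <= e -> 0 <= N -> 0 <= D ->
  e' <= (1 + p / 2) * M1 + (1 + (p / 2)^-1) * M2 ->
  M1 = (1 - p) * e + G^-1 ^+ 2 * SN ->
  M2 <= beta / (G * (G - 1)) * (p * S1 + S2) ->
  S1 <= 2 * G * (G * (B * N' + zeta ^+ 2)) -> N' <= 2 * N + 2 * (L ^+ 2 * D) ->
  S2 <= (1 - p) * (2 * G * (G * (Lpm ^+ 2 * D))) + 2 * G * SN ->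
  SN <= (1 - p) * (omega * (G * ((L ^+ 2 + Lpm ^+ 2) * D)) + (1 + omega) * (G * lb * D)) ->
  A = 48 * B * L ^+ 2 * beta / p
    + 6 * (1 - p) / p * (4 * beta / p + 1 / (2 * G)) * (omega * L ^+ 2 + (1 + omega) * lb)
    + 6 * (1 - p) / p * (4 * beta * (1 + omega) / p + omega / (2 * G)) * Lpm ^+ 2 ->
  e' <= (1 - p / 2) * e + 24 * beta * B * N + 12 * beta * zeta ^+ 2 + p * A / 2 * D.
Proof.
move=> G2 om0 lb0 e0 N0 D0 he' hM1 hM2 hS1 hN' hS2 hSN ->.
have G0 : 0 < G by lra.
have G1 : 0 < G - 1 by lra.
have q0 : 0 <= 1 - p by rewrite subr_ge0.
have pp0 := p0; have pp1 := p1.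
pose T := (omega * (L ^+ 2 + Lpm ^+ 2) + (1 + omega) * lb) * D.
have T0 : 0 <= T.
  apply: mulr_ge0 => //; apply: addr_ge0; apply: mulr_ge0 => //; last lra.
  by apply: addr_ge0; exact: sqr_ge0.
have SNT : SN <= (1 - p) * (G * T).
  by apply: le_trans hSN _; rewrite /T le_eqVlt; apply/orP; left; apply/eqP; ring.
pose V := 2 * (B * N) + 2 * (B * (L ^+ 2 * D)) + zeta ^+ 2.
have V0 : 0 <= V.
  have LD : 0 <= L ^+ 2 * D by apply: mulr_ge0 => //; exact: sqr_ge0.
  have BN := mulr_ge0 B0 N0; have BLD := mulr_ge0 B0 LD; have := sqr_ge0 zeta.
  rewrite /V; lra.
have S1V : S1 <= 2 * G * (G * V).
  apply: le_trans hS1 _; rewrite ler_pM2l; last lra.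
  rewrite ler_pM2l// /V.
  have : B * N' <= B * (2 * N + 2 * (L ^+ 2 * D)) by exact: ler_wpM2l.
  lra.
pose U := Lpm ^+ 2 * D + T.
have U0 : 0 <= U by rewrite addr_ge0// mulr_ge0 ?sqr_ge0.
have S2U : S2 <= (1 - p) * (2 * G * (G * U)).
  apply: le_trans hS2 _.
  have : 2 * G * SN <= 2 * G * ((1 - p) * (G * T)) by rewrite ler_wpM2l//; lra.
  rewrite /U; lra.
pose Y := p * V + (1 - p) * U.
have Y0 : 0 <= Y by rewrite addr_ge0// mulr_ge0// ltW.
have M2Y : M2 <= 4 * beta * Y.
  apply: le_trans hM2 _.
  have h1 : p * S1 + S2 <= 2 * G * G * Y.
    have : p * S1 <= p * (2 * G * (G * V)) by rewrite ler_wpM2l// ltW.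
    by rewrite /Y; lra.
  have c0 : 0 <= beta / (G * (G - 1)) by rewrite divr_ge0// mulr_ge0// ltW.
  apply: le_trans (ler_wpM2l c0 h1) _.
  have -> : beta / (G * (G - 1)) * (2 * G * G * Y) = beta * Y * (2 * G / (G - 1)).
    by field; rewrite !gt_eqF.
  (* At least two good workers make this ratio at most 4; hence the factors [4 * beta] in [A]. *)
  have : 2 * G / (G - 1) <= 4 by rewrite ler_pdivrMr//; lra.
  have bY : 0 <= beta * Y by exact: mulr_ge0.
  by move=> /(ler_wpM2l bY); lra.
have M1T : M1 <= (1 - p) * e + (1 - p) * T / G.
  rewrite hM1 lerD2l.
  have GG : 0 <= G^-1 ^+ 2 by exact: sqr_ge0.
  apply: le_trans (ler_wpM2l GG SNT) _; rewrite le_eqVlt; apply/orP; left.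
  by apply/eqP; field; rewrite gt_eqF.
(* [(1 + p / 2) * (1 - p) <= 1 - p / 2] on the old error, and [1 + p / 2 <= 3 / 2] on the noise. *)
have h1 : (1 + p / 2) * M1 <= (1 - p / 2) * e + 3 / 2 * ((1 - p) * T / G).
  have a0 : 0 <= 1 + p / 2 by lra.
  apply: le_trans (ler_wpM2l a0 M1T) _; rewrite mulrDr; apply: lerD.
    rewrite mulrA ler_wpM2r//; nra.
  apply: ler_wpM2r; last lra.
  by apply: divr_ge0; [exact: mulr_ge0|exact: ltW].
have h2 : (1 + (p / 2)^-1) * M2 <= 3 / p * (4 * beta * Y).
  have bY : 0 <= 4 * beta * Y by rewrite !mulr_ge0.
  have pp : 1 + (p / 2)^-1 <= 3 / p.
    rewrite invf_div -(ler_pM2r p0) mulrDl mul1r !divfK ?gt_eqF//; lra.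
  have a0 : 0 <= 1 + (p / 2)^-1 by rewrite addr_ge0// invr_ge0; lra.
  apply: le_trans (ler_wpM2l a0 M2Y) _.
  by apply: ler_wpM2r.
apply: le_trans he' _; apply: le_trans (lerD h1 h2) _.
(* What remains is an identity: [p * A / 2] collects the coefficients of [D], while 24 and 12 are
   [3 * 4] times the coefficients 2 and 1 in [V]. *)
rewrite le_eqVlt; apply/orP; left; apply/eqP.
by rewrite /Y /U /V /T; field; rewrite !gt_eqF.
Qed.

Hypotheses (mu0 : 0 < mu) (gamma0 : 0 < gamma) (L0 : 0 <= L) (A0 : 0 <= A).
Hypothesis Bp : 96 * B * beta < p.
Let rho := 1 - 96 * B * beta / p.
Hypothesis gammaA : gamma <= 1 / (L + Num.sqrt (2 * A)).
Hypothesis gammamu : gamma <= p / (4 * mu * rho).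

Lemma rho_gt0 : 0 < rho.
Proof. by rewrite subr_gt0 ltr_pdivrMr// mul1r. Qed.

Lemma contraction_le : gamma * mu * rho <= p / 4.
Proof.
have mr : 0 < 4 * mu * rho by rewrite !mulr_gt0// rho_gt0.
by move: gammamu; rewrite ler_pdivlMr//; lra.
Qed.

(** With [s] the square root of [2 * A], the hypothesis reads [gamma * L + gamma * s <= 1]. In
    particular [gamma * s <= 1], so squaring it only makes it smaller. *)
Lemma stepsize_le : L * gamma + 2 * A * gamma ^+ 2 <= 1.
Proof.
have s0 : 0 <= Num.sqrt (2 * A) := sqrtr_ge0 _.
have ss : Num.sqrt (2 * A) ^+ 2 = 2 * A by rewrite sqr_sqrtr// mulr_ge0.
move: gammaA ss s0; move: (Num.sqrt (2 * A)) => s gs <- s0.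
(* if [L + s = 0] then [1 / (L + s)] is [0], contradicting [0 < gamma] *)
have Ls : 0 < L + s.
  rewrite lt_neqAle addr_ge0// andbT eq_sym; apply/eqP => Ls0.
  by move: gs; rewrite Ls0 invr0 mulr0 leNgt gamma0.
move: gs; rewrite ler_pdivlMr// => gs.
have t0 : 0 <= gamma * s by rewrite mulr_ge0// ltW.
have t1 : gamma * s <= 1 by have := mulr_ge0 (ltW gamma0) L0; lra.
have : (gamma * s) * (gamma * s) <= gamma * s by rewrite ler_piMl.
by rewrite -expr2 exprMn; lra.
Qed.

Lemma lyapunov_step (F F' e e' N D : R) :
  0 <= e -> 0 <= D ->
  F' <= F - gamma / 2 * N - ((2 * gamma)^-1 - L / 2) * D + gamma / 2 * e ->
  e' <= (1 - p / 2) * e + 24 * beta * B * N + 12 * beta * zeta ^+ 2 + p * A / 2 * D ->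
  2 * mu * F <= N ->
  F' + 2 * gamma / p * e' <= (1 - gamma * mu * rho) * (F + 2 * gamma / p * e)
    + 24 * gamma * beta * zeta ^+ 2 / p.
Proof.
move=> e0 D0 hF he hN.
have gp : 0 < 2 * gamma / p by rewrite divr_gt0// mulr_gt0.
have he' := ler_wpM2l (ltW gp) he.
have hc : 2 * gamma / p * e * (gamma * mu * rho) <= 2 * gamma / p * e * (p / 4).
  by rewrite ler_wpM2l ?contraction_le// mulr_ge0// ltW.
have hN' : gamma / 2 * rho * (2 * mu * F) <= gamma / 2 * rho * N.
  by rewrite ler_wpM2l// mulr_ge0 ?divr_ge0 ?ltW// rho_gt0.
have hD : 0 <= (1 - (L * gamma + 2 * A * gamma ^+ 2)) * (D / (2 * gamma)).
  by rewrite mulr_ge0 ?subr_ge0 ?stepsize_le// divr_ge0// mulr_ge0// ltW.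
apply: le_trans (lerD hF he') _; rewrite -subr_ge0.
(* The gap is exactly a sum of three nonnegative terms: contraction of the error, the
   Polyak-Lojasiewicz inequality, and the stepsize condition. The coefficient of [N] is [gamma / 2 -
   2 * gamma / p * (24 * beta * B)], that is [gamma / 2 * rho], which explains the 96. *)
have -> : (1 - gamma * mu * rho) * (F + 2 * gamma / p * e) + 24 * gamma * beta * zeta ^+ 2 / p
  - (F - gamma / 2 * N - ((2 * gamma)^-1 - L / 2) * D + gamma / 2 * e
     + 2 * gamma / p * ((1 - p / 2) * e + 24 * beta * B * N + 12 * beta * zeta ^+ 2 + p * A / 2 * D))
  = (2 * gamma / p * e * (p / 4) - 2 * gamma / p * e * (gamma * mu * rho))
    + (gamma / 2 * rho * N - gamma / 2 * rho * (2 * mu * F))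
    + (1 - (L * gamma + 2 * A * gamma ^+ 2)) * (D / (2 * gamma)).
  by rewrite /rho; field; rewrite !gt_eqF.
by apply: addr_ge0 => //; apply: addr_ge0; rewrite subr_ge0.
Qed.

Lemma lyapunov_rate (F e N D : nat -> R) K :
  (forall k, 0 <= e k) -> (forall k, 0 <= D k) ->
  (forall k, F k.+1 <= F k - gamma / 2 * N k - ((2 * gamma)^-1 - L / 2) * D k
     + gamma / 2 * e k) ->
  (forall k, e k.+1 <= (1 - p / 2) * e k + 24 * beta * B * N k
     + 12 * beta * zeta ^+ 2 + p * A / 2 * D k) ->
  (forall k, 2 * mu * F k <= N k) ->
  F K <= (1 - gamma * mu * rho) ^+ K * (F 0%N + 2 * gamma / p * e 0%N)
     + 24 * beta * zeta ^+ 2 / (mu * (p - 96 * B * beta)).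
Proof.
move=> e0 D0 hF he hN.
set tail := _ / (mu * _).
(* The additive term is the fixed point of the affine recursion, that is, the sum of its geometric
   series. *)
have tailE : tail = (1 - gamma * mu * rho) * tail + 24 * gamma * beta * zeta ^+ 2 / p.
  have d0 : p - 96 * B * beta != 0 by rewrite gt_eqF// subr_gt0.
  by rewrite /tail /rho; field; rewrite d0 !gt_eqF.
have r0 : 0 <= 1 - gamma * mu * rho by have := contraction_le; have := p1; lra.
have tail0 : 0 <= tail.
  apply: divr_ge0; last by apply: mulr_ge0; [exact: ltW|rewrite subr_ge0 ltW].
  by apply: mulr_ge0; [apply: mulr_ge0|exact: sqr_ge0].
(* The induction runs on the whole Lyapunov function; its error term is dropped only at the end. *)
suff h : F K + 2 * gamma / p * e K <=
    (1 - gamma * mu * rho) ^+ K * (F 0%N + 2 * gamma / p * e 0%N) + tail.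
  apply: le_trans h; rewrite lerDl; apply: mulr_ge0 => //.
  by apply: divr_ge0; [apply: mulr_ge0 => //|]; exact: ltW.
elim: K => [|k IH]; first by rewrite expr0 mul1r lerDl.
apply: le_trans (lyapunov_step (e0 k) (D0 k) (hF k) (he k) (hN k)) _.
rewrite [X in _ <= _ + X]tailE addrA lerD2r exprS.
by apply: le_trans (ler_wpM2l r0 IH) _; rewrite mulrDr !mulrA.
Qed.

End rates.

(** * Byz-VR-MARINA *)

Section byz_vr_marina.
Context (R : realType) (d n m : nat) (good : {set 'I_n}).
Context (fij : 'I_n -> 'I_m -> 'rV[R]_d -> R).
Context (L B zeta Lpm lb omega beta p gamma : R).
Context (dO : measure_display) (Om : measurableType dO) (P : probability Om R).
Context (dS : measure_display) (S : measurableType dS) (nuS : 'I_n -> probability S R).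
Context (Dhat : 'I_n -> 'rV[R]_d -> 'rV[R]_d -> S -> 'rV[R]_d).
Context (dU : measure_display) (U : measurableType dU) (nuU : probability U R).
Context (Q : 'rV[R]_d -> U -> 'rV[R]_d).
Context (F0 : set (set Om)) (cc : nat -> Om -> bool).
Context (xi : nat -> 'I_n -> Om -> S) (eta : nat -> 'I_n -> Om -> U).
Context (x0 : 'rV[R]_d) (x g : nat -> Om -> 'rV[R]_d).
Context (gi : nat -> 'I_n -> Om -> 'rV[R]_d).

Let G := #|good|.
Let fi (i : 'I_n) (y : 'rV[R]_d) := m%:R^-1 * \sum_(j < m) fij i j y.
Let f (y : 'rV[R]_d) := G%:R^-1 * \sum_(i in good) fi i y.
Let past := bvr_past good F0 cc xi eta.
Let gbar k w := G%:R^-1 *: \sum_(i in good) gi k i w.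
Let sys := bvr_sys good F0 cc xi eta.
Local Notation Rest j := (g_sigma_algebraType (rest sys j)).

Hypothesis G1 : (1 < G)%N.
Hypothesis dfij : forall i, i \in good ->
  forall (j : 'I_m) (y : 'rV[R]_d), differentiable (fij i j) y.
Hypothesis L0 : 0 <= L.
Hypothesis smooth : forall y z, enorm (grad f y - grad f z) <= L * enorm (y - z).
Hypothesis hetero : forall y,
  G%:R^-1 * \sum_(i in good) sqn (grad (fi i) y - grad f y)
    <= B * sqn (grad f y) + zeta ^+ 2.
Hypothesis hessvar : forall y z,
  G%:R^-1 * \sum_(i in good) sqn (grad (fi i) y - grad (fi i) z)
    - sqn (grad f y - grad f z) <= Lpm ^+ 2 * sqn (y - z).
Hypothesis lb0 : 0 <= lb.
Hypothesis mDhat : forall i, i \in good -> forall j : 'I_d,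
  measurable_fun setT
    (fun z : (vecM R d * vecM R d * S)%type => Dhat i z.1.1 z.1.2 z.2 0 j).
Hypothesis Dhat_mean : forall i, i \in good -> forall (y z : 'rV[R]_d) (j : 'I_d),
  (nuS i).-integrable setT (fun s => (Dhat i y z s 0 j)%:E) /\
  (\int[nuS i]_s (Dhat i y z s 0 j)%:E
     = ((grad (fi i) y - grad (fi i) z) 0 j)%:E)%E.
Hypothesis Dhat_var : forall y z : 'rV[R]_d,
  ((G%:R^-1)%:E * \sum_(i in good)
     \int[nuS i]_s (sqn (Dhat i y z s - (grad (fi i) y - grad (fi i) z)))%:E
   <= (lb * sqn (y - z))%:E)%E.
Hypothesis omega0 : 0 <= omega.
Hypothesis mQ : forall j : 'I_d,
  measurable_fun setT (fun z : (vecM R d * U)%type => Q z.1 z.2 0 j).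
Hypothesis Q_mean : forall (y : 'rV[R]_d) (j : 'I_d),
  nuU.-integrable setT (fun u => (Q y u 0 j)%:E) /\
  (\int[nuU]_u (Q y u 0 j)%:E = (y 0 j)%:E)%E.
Hypothesis Q_var : forall y : 'rV[R]_d,
  (\int[nuU]_u (sqn (Q y u - y))%:E <= (omega * sqn y)%:E)%E.
Hypothesis F0s : sigma_algebra setT F0.
Hypothesis mcc : forall k, measurable_fun setT (cc k).
Hypothesis Pcc : forall k, P [set w | cc k w] = p%:E.
Hypothesis xi_law : forall k i, i \in good -> forall C, measurable C ->
  P (xi k i @^-1` C) = nuS i C.
Hypothesis eta_law : forall k i, i \in good -> forall C, measurable C ->
  P (eta k i @^-1` C) = nuU C.
Hypothesis indep : mutually_independent P sys.
Hypothesis x_0 : forall w, x 0%N w = x0.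
Hypothesis mg0 : vec_meas_wrt F0 (g 0%N).
Hypothesis x_S : forall k w, x k.+1 w = x k w - gamma *: g k w.
Hypothesis gi_S : forall k i w, i \in good ->
  gi k.+1 i w = if cc k w then grad (fi i) (x k.+1 w)
                else g k w + Q (Dhat i (x k.+1 w) (x k w) (xi k i w)) (eta k i w).
Hypothesis mg : forall k, vec_meas_wrt (past k.+1) (g k.+1).
Hypothesis robust : forall k,
  (\int[P]_w (sqn (g k.+1 w - gbar k.+1 w))%:E
   <= (beta / (G%:R * (G%:R - 1)))%:E *
      \sum_(i in good) \sum_(l in good)
         \int[P]_w (sqn (gi k.+1 i w - gi k.+1 l w))%:E)%E.
Hypothesis p0 : 0 < p.
Hypothesis p1 : p <= 1.
Hypothesis beta0 : 0 <= beta.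
Hypothesis B0 : 0 <= B.

Let G0 : (0 : R) < G%:R.
Proof. by rewrite ltr0n (ltn_trans _ G1). Qed.

Let dfi i y : i \in good -> differentiable (fi i) y.
Proof.
move=> ig; apply: differentiable_scale.
by apply: (differentiable_bigsum _ _).1 => j _; exact: dfij.
Qed.

Let df y : differentiable f y.
Proof.
by apply: differentiable_scale; apply: (differentiable_bigsum _ _).1 => i; exact: dfi.
Qed.

Let grad_f y : grad f y = G%:R^-1 *: \sum_(i in good) grad (fi i) y.
Proof.
have [ds gs] := differentiable_bigsum (index_enum 'I_n) (p := mem good) (F := fi)
  (x := y) (fun i ig => dfi y ig).
by rewrite /f gradZ// gs.
Qed.

Let smooth_sqn y z : sqn (grad f y - grad f z) <= L ^+ 2 * sqn (y - z).
Proof. exact: enorm_le_sqn. Qed.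

Let sum_smooth y z : \sum_(i in good) sqn (grad (fi i) y - grad (fi i) z)
  <= G%:R * ((L ^+ 2 + Lpm ^+ 2) * sqn (y - z)).
Proof.
rewrite -ler_pdivrMl//; have := hessvar y z; have := smooth_sqn y z.
by rewrite mulrDl; lra.
Qed.

(** A crude constant, obtained by bounding one term by the sum; it serves only for measurability and
    square integrability of the individual gradients. *)
Let fi_smooth i : i \in good -> forall y z, sqn (grad (fi i) y - grad (fi i) z)
  <= G%:R * (L ^+ 2 + Lpm ^+ 2) * sqn (y - z).
Proof.
move=> ig y z; rewrite -mulrA; apply: le_trans (sum_smooth y z).
rewrite (bigD1 i)//= lerDl; apply: sumr_ge0 => l _; exact: sqn_ge0.
Qed.

Let hetero_pairs y :
  \sum_(i in good) \sum_(l in good) sqn (grad (fi i) y - grad (fi l) y)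
    <= 2 * G%:R * (G%:R * (B * sqn (grad f y) + zeta ^+ 2)).
Proof.
rewrite sum_sqn_sub -grad_f ler_pM2l; last by rewrite mulr_gt0.
by rewrite -ler_pdivrMl.
Qed.

Let hessvar_pairs y z :
  \sum_(i in good) \sum_(l in good)
     sqn ((grad (fi i) y - grad (fi i) z) - (grad (fi l) y - grad (fi l) z))
    <= 2 * G%:R * (G%:R * (Lpm ^+ 2 * sqn (y - z))).
Proof.
rewrite sum_sqn_sub ler_pM2l; last by rewrite mulr_gt0.
rewrite -ler_pdivrMl//; apply: le_trans (hessvar y z).
rewrite sum_sqn_dev ?(ltn_trans _ G1)//.
rewrite [X in sqn X](_ : _ = grad f y - grad f z) ?sumrB ?scalerBr -?grad_f//.
by rewrite mulrBr mulrA mulVf ?mul1r// gt_eqF.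
Qed.

Let sys_sigma j : sigma_algebra setT (sys j).
Proof.
have trivial_sigma : sigma_algebra setT (@trivial_sys Om).
  split.
  - by left.
  - move=> A [->|->]; [right|left]; first by rewrite setD0.
    by rewrite setDv.
  - move=> A hA; have [[i Ai]|nA] := pselect (exists i, A i = setT).
      by right; apply/seteqP; split => // w _; exists i => //; rewrite Ai.
    left; apply/seteqP; split => // w [i _]; case: (hA i) => [->//|Ai].
    by case: nA; exists i.
have pre_sigma d' (T' : measurableType d') (Y : Om -> T') :
    sigma_algebra setT (preimage_set_system setT Y measurable).
  exact: sigma_algebra_preimage (@sigma_algebra_measurable _ T').
rewrite /sys; case: j => [[k [[i []]|]]|] //=; by case: ifP.
Qed.

Let later k (j : sidx n) := exists k' t, j = Some (k', t) /\ (k <= k')%N.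

(** The form of adaptedness that the independence lemmas use: for each single source [j] of round
    [k] or later, [X] can be computed without [j]. *)
Let Pm k (X : Om -> 'rV[R]_d) := forall j, later k j -> @vec_measurable R d _ (Rest j) X.

Let PmS k X : Pm k X -> Pm k.+1 X.
Proof.
by move=> pX j [k' [t [-> kk']]]; apply: pX; exists k', t; split => //; exact: ltnW.
Qed.

Let past_rest k j : later k j -> past k `<=` <<s rest sys j>>.
Proof.
move=> [k' [t [-> kk']]]; apply: smallest_sub; first exact: smallest_sigma_algebra.
move=> A [F0A|[k'' [t' [lt sA]]]]; apply: sub_sigma_algebra.
  by exists None.
exists (Some (k'', t')) => //=; apply/eqP => -[E _].
by move: lt; rewrite E ltnNge kk'.
Qed.

Let Pm_g k : Pm k (g k).
Proof.
case: k => [|k] j lj i _ D mD; rewrite setTI.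
  move: lj => [k' [t [-> _]]]; apply: sub_sigma_algebra; exists None => //.
  exact: mg0.
by apply: (past_rest lj); exact: mg.
Qed.

Let Pm_x k : Pm k (x k).
Proof.
elim: k => [|k IH].
  by rewrite (_ : x 0%N = fun=> x0); [move=> j _ i; exact: measurable_cst|exact/funext].
rewrite (_ : x k.+1 = fun w => x k w - gamma *: g k w); last exact/funext.
have pg := PmS (@Pm_g k); have px := PmS IH => j lj.
apply: vec_measurableB; first exact: px.
by apply: vec_measurableZ; [exact: measurable_cst|exact: pg].
Qed.

(** The index matters: [x k.+1] is determined by [x k] and [g k], hence before the draws of round
    [k], so the gradient differences of that round count as past. *)
Let Pm_xS k : Pm k (x k.+1).
Proof.
rewrite (_ : x k.+1 = fun w => x k w - gamma *: g k w); last exact/funext.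
move=> j lj; apply: vec_measurableB; first exact: Pm_x.
by apply: vec_measurableZ; [exact: measurable_cst|exact: Pm_g].
Qed.

Let Pm_lip k X (h : 'rV[R]_d -> 'rV[R]_d) (C : R) :
  (forall y z, sqn (h y - h z) <= C * sqn (y - z)) -> Pm k X -> Pm k (fun w => h (X w)).
Proof.
move=> hC pX j lj i.
have ch : continuous (fun v => h v 0 i) by exact: continuous_sqn_lipschitz hC.
exact: (vec_measurable_continuous (pX j lj) ch).
Qed.

Let PmB k X Y : Pm k X -> Pm k Y -> Pm k (fun w => X w - Y w).
Proof. by move=> pX pY j lj; apply: vec_measurableB; [exact: pX|exact: pY]. Qed.

Let PmO k X : Pm k X -> vec_measurable X.
Proof.
move=> pX; apply: (vec_measurable_rest indep (j := Some (k, None))).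
by apply: pX; exists k, None.
Qed.

Let L2v_lip k X (h : 'rV[R]_d -> 'rV[R]_d) (C : R) :
  (forall y z, sqn (h y - h z) <= C * sqn (y - z)) -> Pm k X -> L2v P X ->
  L2v P (fun w => h (X w)).
Proof.
move=> hC pX X2.
apply: (@L2v_le _ _ _ _ _ _ (fun w => 2 * (C * sqn (X w)) + 2 * sqn (h 0))).
- exact: PmO (Pm_lip hC pX).
- move=> w; have -> : h (X w) = (h (X w) - h 0) + h 0 by rewrite subrK.
  apply: le_trans (sqnD_le _ _) _; rewrite lerD2r ler_wpM2l//.
  by have := hC (X w) 0; rewrite subr0.
- apply: integrableDR; last exact: integrable_cstR.
  by do 2 apply: integrableZR; exact: L2v_sqn.
Qed.

Let jc k : sidx n := Some (k, None).
Let jx k i : sidx n := Some (k, Some (i, true)).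
Let je k i : sidx n := Some (k, Some (i, false)).

Let Pm_past k X : Pm k X -> past_measurable sys good (jc k) (jx k) (je k) X.
Proof.
move=> pX j cj; apply: pX.
by case: cj => [->|[i _ [->|->]]]; eexists k, _.
Qed.

(** [neg] is the identity for the round of exact gradients and negation for the round of compressed
    differences. *)
Let coinF k (neg : bool -> bool) D : sys (jc k) ((fun w => neg (cc k w)) @^-1` D).
Proof.
exists (neg @^-1` D) => //.
by rewrite setTI.
Qed.

Let xi_source k i : i \in good -> source P sys (jx k i) (xi k i) (nuS i).
Proof.
move=> ig; split => C mC; last exact: xi_law.
by rewrite /sys /= ig; exists C => //; rewrite setTI.
Qed.

Let eta_source k i : i \in good -> source P sys (je k i) (eta k i) nuU.
Proof.
move=> ig; split => C mC; last exact: eta_law.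
by rewrite /sys /= ig; exists C => //; rewrite setTI.
Qed.

Let integrable_bool (neg : bool -> bool) k :
  P.-integrable setT (EFin \o (fun w => (neg (cc k w))%:R : R)).
Proof.
apply: (@integrable_le _ _ _ _ _ (fun=> 1)) => //; last exact: integrable_cstR.
- have mb : measurable_fun setT (fun u : bool => (neg u)%:R : R) by [].
  exact: (measurableT_comp mb (mcc k)).
- by move=> w; rewrite ger0_norm ?ler0n//; case: (neg _).
Qed.

Let mean_cc k : \int[P]_w (cc k w)%:R = p.
Proof.
apply: EFin_inj; rewrite (EFin_Rintegral (integrable_bool id k)) -(Pcc k).
have mset : measurable [set w | cc k w].
  have := mcc k measurableT (Y := [set true]); rewrite setTI; apply.
  by [].
transitivity (\int[P]_w (\1_[set w | cc k w] w)%:E)%E; last first.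
  by rewrite integral_indic// setIT.
apply: eq_integral => w _; rewrite indicE.
by have -> : (w \in [set w | cc k w]) = cc k w by apply/idP/idP; rewrite inE.
Qed.

Let mean_ncc k : \int[P]_w (~~ cc k w)%:R = 1 - p.
Proof.
rewrite -(mean_cc k) -[X in X - _](Rintegral_cstP P).
rewrite -RintegralB//; [|exact: integrable_cstR|exact: (integrable_bool id)].
by apply: eq_Rintegral => w _; case: (cc k w); rewrite ?subrr ?subr0.
Qed.

Let e_ k := Esqn P (fun w => g k w - grad f (x k w)).
Let N_ k := Esqn P (fun w => grad f (x k w)).
Let D_ k := Esqn P (fun w => x k.+1 w - x k w).
Let A := 48 * B * L ^+ 2 * beta / p
  + 6 * (1 - p) / p * (4 * beta / p + 1 / (2 * G%:R)) * (omega * L ^+ 2 + (1 + omega) * lb)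
  + 6 * (1 - p) / p * (4 * beta * (1 + omega) / p + omega / (2 * G%:R)) * Lpm ^+ 2.

Let le_Esqn X (h : Om -> R) : L2v P X -> P.-integrable setT (EFin \o h) ->
  (forall w, sqn (X w : 'rV[R]_d) <= h w) -> Esqn P X <= \int[P]_w h w.
Proof.
by move=> X2 ih Xh; apply: le_Rintegral => //; exact: L2v_sqn.
Qed.

Let L2v_bool (neg : bool -> bool) k X : L2v P X ->
  L2v P (fun w => (neg (cc k w))%:R *: X w : 'rV[R]_d).
Proof.
move=> X2; apply: (@L2v_le _ _ _ _ _ _ (fun w => sqn (X w))); last exact: L2v_sqn.
  apply: vec_measurableZ; last by case: X2.
  by apply/measurable_EFinP; case/integrableP: (integrable_bool neg k).
by move=> w; rewrite sqnZ ler_piMl ?sqn_ge0//; case: (neg _); rewrite ?expr1n ?expr0n.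
Qed.

(** * Error recursion over one iteration *)

Section step.
Context (k : nat) (x2 : L2v P (x k)) (g2 : L2v P (g k)).

Let x'2 : L2v P (x k.+1).
Proof.
rewrite (_ : x k.+1 = fun w => x k w - gamma *: g k w); last exact/funext.
by apply: L2vB => //; exact: L2vZ.
Qed.

Let Qv i w := Q (Dhat i (x k.+1 w) (x k w) (xi k i w)) (eta k i w).
Let c w : R := (cc k w)%:R.
Let nc w : R := (~~ cc k w)%:R.

Let gi_split i w : i \in good -> gi k.+1 i w =
  c w *: grad (fi i) (x k.+1 w) + nc w *: (g k w + Qv i w).
Proof.
move=> ig; rewrite gi_S// /c /nc; case: (cc k w) => /=.
  by rewrite scale1r scale0r addr0.
by rewrite scale1r scale0r add0r.
Qed.

Let xx2 : L2v P (fun w => x k.+1 w - x k w).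
Proof. exact: L2vB. Qed.

Let gf2 : L2v P (fun w => grad f (x k w)).
Proof. exact: (L2v_lip smooth_sqn (@Pm_x k)). Qed.

Let gf'2 : L2v P (fun w => grad f (x k.+1 w)).
Proof. exact: (L2v_lip smooth_sqn (@Pm_xS k)). Qed.

Let gfi2 i : i \in good -> L2v P (fun w => grad (fi i) (x k w)).
Proof. by move=> ig; exact: (L2v_lip (fi_smooth ig) (@Pm_x k)). Qed.

Let gfi'2 i : i \in good -> L2v P (fun w => grad (fi i) (x k.+1 w)).
Proof. by move=> ig; exact: (L2v_lip (fi_smooth ig) (@Pm_xS k)). Qed.

Let Dl i w := grad (fi i) (x k.+1 w) - grad (fi i) (x k w).

Let Pm_gfi' i : i \in good -> Pm k (fun w => grad (fi i) (x k.+1 w)).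
Proof. by move=> ig; exact: (Pm_lip (fi_smooth ig) (@Pm_xS k)). Qed.

Let Pm_Dl i : i \in good -> Pm k (Dl i).
Proof.
by move=> ig; apply: PmB; [exact: Pm_gfi'|exact: (Pm_lip (fi_smooth ig) (@Pm_x k))].
Qed.

Let Dl2 i : i \in good -> L2v P (Dl i).
Proof. by move=> ig; apply: L2vB; [exact: gfi'2|exact: gfi2]. Qed.

Let e2 : L2v P (fun w => g k w - grad f (x k w)).
Proof. exact: L2vB. Qed.

Let Pm_e : Pm k (fun w => g k w - grad f (x k w)).
Proof. by apply: PmB; [exact: Pm_g|exact: (Pm_lip smooth_sqn (@Pm_x k))]. Qed.

Let variance : exists SN : 'I_n -> R,
  [/\ \sum_(i in good) SN i <= (1 - p) * (omega * (\sum_(i in good) Esqn P (Dl i))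
        + (1 + omega) * (G%:R * lb * D_ k)),
      (forall s, Esqn P (fun w => nc w *:
          ((g k w - grad f (x k w)) + s *: \sum_(i in good) (Qv i w - Dl i w)))
        = (1 - p) * e_ k + s ^+ 2 * \sum_(i in good) SN i),
      (forall i l, i \in good -> l \in good ->
        Esqn P (fun w => nc w *: (Qv i w - Qv l w)) <=
          (1 - p) * Esqn P (fun w => Dl i w - Dl l w) + (SN i + SN l)) &
      (forall i, i \in good -> L2v P (fun w => nc w *: Qv i w))].
Proof.
have Dv w : (\sum_(i in good) \int[nuS i]_s (sqn (Dhat i (x k.+1 w) (x k w) s - Dl i w))%:E
    <= (G%:R * lb * sqn (x k.+1 w - x k w))%:E)%E.
  have := Dhat_var (x k.+1 w) (x k w); rewrite lee_pdivrMl//.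
  by rewrite -EFinM mulrA.
have := @round_variance _ _ _ P _ sys indep sys_sigma d _ good _ _ nuS Dhat _ _ nuU Q
  omega (G%:R * lb) (jc k) (jx k) (je k) _ _ _ _ _ (fun w => ~~ cc k w) (xi k) (eta k)
  (coinF k negb) (fun i => @xi_source k i) (fun i => @eta_source k i)
  (x k.+1) (x k) Dl (Pm_past (@Pm_xS k)) (Pm_past (@Pm_x k))
  (fun i ig => Pm_past (Pm_Dl ig)) Dl2 xx2 omega0 _ mDhat
  (fun i ig w => Dhat_mean ig (x k.+1 w) (x k w)) Dv mQ Q_mean Q_var.
rewrite /= mean_ncc => -[||||||SN [h1 h2 h3 h4]].
- by move=> i; apply/eqP.
- by move=> i; apply/eqP.
- by move=> i l; apply/eqP => -[].
- by move=> i l [].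
- by move=> i l [].
- by apply: mulr_ge0 => //; exact: ltW.
exists SN; split => // s.
by apply: h2 => //; exact: Pm_past.
Qed.

(** When the coin is 0, the mean of the [Dl i] is the increment of [grad f]; subtracting it from the
    mean message leaves the previous error and the averaged noise. *)
Let mean_dev w : gbar k.+1 w - grad f (x k.+1 w) =
  nc w *: ((g k w - grad f (x k w)) + G%:R^-1 *: \sum_(i in good) (Qv i w - Dl i w)).
Proof.
have -> : gbar k.+1 w = c w *: grad f (x k.+1 w) +
    nc w *: (g k w + G%:R^-1 *: \sum_(i in good) Qv i w).
  rewrite /gbar (eq_bigr _ (fun i => @gi_split i w)) big_split /= scalerDr.
  rewrite -!scaler_sumr big_split /= sumr_const grad_f; congr (_ + _).
    by rewrite !scalerA mulrC.
  rewrite !scalerA [G%:R^-1 * _]mulrC -scalerA scalerDr; congr (_ *: (_ + _)).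
  by rewrite -[g k w *+ _]scaler_nat scalerA mulVf ?gt_eqF// scale1r.
rewrite sumrB scalerBr sumrB scalerBr -!grad_f /c /nc; case: (cc k w) => /=.
  by rewrite scale1r !scale0r addr0 subrr.
by rewrite !scale1r scale0r add0r; apply/rowP => j; rewrite !mxE; ring.
Qed.

(** Exactly one of [c w] and [nc w] is nonzero, so there is no cross term; the common vector [g k w]
    cancels in the difference. *)
Let gi_diff i l w : i \in good -> l \in good -> sqn (gi k.+1 i w - gi k.+1 l w) =
  sqn (c w *: (grad (fi i) (x k.+1 w) - grad (fi l) (x k.+1 w)))
    + sqn (nc w *: (Qv i w - Qv l w)).
Proof.
move=> ig lg; rewrite !gi_split// /c /nc; case: (cc k w) => /=.
  by rewrite !scale1r !scale0r !addr0 sqn0 addr0.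
by rewrite !scale1r !scale0r !add0r sqn0 add0r; congr sqn; apply/rowP => j; rewrite !mxE; ring.
Qed.

Lemma variance_step : [/\ L2v P (x k.+1), L2v P (g k.+1) &
  e_ k.+1 <= (1 - p / 2) * e_ k + 24 * beta * B * N_ k + 12 * beta * zeta ^+ 2
    + p * A / 2 * D_ k].
Proof.
have [SN [hSN hmean hpair Q2]] := variance.
have G2 : 2 <= G%:R :> R by rewrite ler_nat.
have dQ2 i l : i \in good -> l \in good -> L2v P (fun w => nc w *: (Qv i w - Qv l w)).
  move=> ig lg; under eq_fun do rewrite scalerBr.
  by apply: L2vB; exact: Q2.
pose dG i l w := grad (fi i) (x k.+1 w) - grad (fi l) (x k.+1 w).
have dG2 i l : i \in good -> l \in good -> L2v P (dG i l).
  by move=> ig lg; apply: L2vB; exact: gfi'2.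
have cdG2 i l : i \in good -> l \in good -> L2v P (fun w => c w *: dG i l w).
  by move=> ig lg; exact: (L2v_bool id k (dG2 i l ig lg)).
pose S1 := \sum_(i in good) \sum_(l in good) Esqn P (dG i l).
pose S2 := \sum_(i in good) \sum_(l in good) Esqn P (fun w => nc w *: (Qv i w - Qv l w)).
have EdG i l : i \in good -> l \in good -> Esqn P (fun w => c w *: dG i l w) = p * Esqn P (dG i l).
  move=> ig lg; have pd : Pm k (dG i l) by apply: PmB; exact: Pm_gfi'.
  have := @Esqn_coin _ _ _ P _ sys indep sys_sigma d _ good (jc k) (jx k) (je k) (cc k)
    (coinF k id) (dG i l) (Pm_past pd) (dG2 i l ig lg).
  by rewrite /= mean_cc.
have pairs : (\sum_(i in good) \sum_(l in good)
    \int[P]_w (sqn (gi k.+1 i w - gi k.+1 l w))%:E = (p * S1 + S2)%:E)%E.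
  have -> : p * S1 + S2 = \sum_(i in good) \sum_(l in good)
      (p * Esqn P (dG i l) + Esqn P (fun w => nc w *: (Qv i w - Qv l w))).
    rewrite /S1 /S2 mulr_sumr -big_split /=; apply: eq_bigr => i _.
    by rewrite mulr_sumr -big_split.
  rewrite -sumEFin; apply: eq_bigr => i ig; rewrite -sumEFin; apply: eq_bigr => l lg.
  rewrite -EdG// /Esqn -RintegralD//; [|exact: L2v_sqn (cdG2 i l ig lg)|exact: L2v_sqn (dQ2 i l ig lg)].
  rewrite EFin_Rintegral; last first.
    by apply: integrableDR; [exact: L2v_sqn (cdG2 i l ig lg)|exact: L2v_sqn (dQ2 i l ig lg)].
  by apply: eq_integral => w _; rewrite gi_diff.
have gi2 i : i \in good -> L2v P (gi k.+1 i).
  move=> ig; rewrite (_ : gi k.+1 i = fun w => c w *: grad (fi i) (x k.+1 w) +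
      (nc w *: g k w + nc w *: Qv i w)); last first.
    by apply/funext => w; rewrite gi_split// scalerDr.
  apply: L2vD; first exact: (L2v_bool id k (gfi'2 ig)).
  by apply: L2vD; [exact: (L2v_bool negb k g2)|exact: Q2].
have gbar2 : L2v P (gbar k.+1).
  by apply: L2vZ; apply: L2v_sum => i ig; exact: gi2.
have mg' : vec_measurable (g k.+1) by exact: PmO (@Pm_g k.+1).
(* The pair sums are finite real numbers, so robustness makes the aggregation error square
   integrable, and then [g k.+1] as well. *)
have dev2 : L2v P (fun w => g k.+1 w - gbar k.+1 w).
  split; first by apply: vec_measurableB => //; case: gbar2.
  apply: le_lt_trans (robust k) _.
  by rewrite pairs -EFinM ltry.
have g'2 : L2v P (g k.+1).
  rewrite (_ : g k.+1 = fun w => (g k.+1 w - gbar k.+1 w) + gbar k.+1 w).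
    exact: L2vD.
  by apply/funext => w; rewrite subrK.
have M2le : Esqn P (fun w => g k.+1 w - gbar k.+1 w) <=
    beta / (G%:R * (G%:R - 1)) * (p * S1 + S2).
  have := robust k; rewrite pairs -EFinM -EFin_Rintegral ?lee_fin//.
  exact: L2v_sqn dev2.
have mdev2 : L2v P (fun w => gbar k.+1 w - grad f (x k.+1 w)) by exact: L2vB.
split => //.
have p20 : 0 < p / 2 by rewrite divr_gt0.
apply: (@variance_recursion _ p beta B zeta L A p0 p1 beta0 B0 G%:R omega lb Lpm (e_ k) _
  (Esqn P (fun w => gbar k.+1 w - grad f (x k.+1 w)))
  (Esqn P (fun w => g k.+1 w - gbar k.+1 w)) (N_ k) (N_ k.+1) (D_ k) S1 S2
  (\sum_(i in good) SN i)) => //; try exact: Esqn_ge0.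
- have i1 := integrableZR (1 + p / 2) (L2v_sqn mdev2).
  have i2 := integrableZR (1 + (p / 2)^-1) (L2v_sqn dev2).
  rewrite -(RintegralZl _ measurableT (L2v_sqn mdev2)) -(RintegralZl _ measurableT (L2v_sqn dev2)).
  rewrite -RintegralD//; apply: le_Esqn; [exact: L2vB|exact: integrableDR|].
  move=> w; have := sqnD_young (gbar k.+1 w - grad f (x k.+1 w)) (g k.+1 w - gbar k.+1 w) p20.
  by rewrite [X in sqn X <= _](_ : _ = g k.+1 w - grad f (x k.+1 w))// addrC addrA subrK.
- by rewrite -hmean; congr (Esqn P _); apply/funext => w; exact: mean_dev.
- rewrite /S1 -[X in X <= _](_ : \int[P]_w (\sum_(i in good) \sum_(l in good) sqn (dG i l w)) = _).
    have iN := integrableZR B (L2v_sqn gf'2).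
    have iNz := integrableDR iN (integrable_cstR P (zeta ^+ 2)).
    rewrite /N_ /Esqn -(RintegralZl _ measurableT (L2v_sqn gf'2)).
    rewrite -[X in _ + X](Rintegral_cstP P) -RintegralD//; last exact: integrable_cstR.
    rewrite -RintegralZl// -RintegralZl//; last exact: integrableZR.
    apply: le_Rintegral => //.
    + apply: integrable_sumR => i ig; apply: integrable_sumR => l lg.
      exact: L2v_sqn (dG2 i l ig lg).
    + by do 2 apply: integrableZR.
    + by move=> w _; exact: hetero_pairs.
  rewrite Rintegral_sum => [|i ig]; last first.
    by apply: integrable_sumR => l lg; exact: L2v_sqn (dG2 i l ig lg).
  apply: eq_bigr => i ig; rewrite Rintegral_sum => [//|l lg].
  exact: L2v_sqn (dG2 i l ig lg).
- have i1 := integrableZR 2 (L2v_sqn gf2).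
  have i2 := integrableZR (L ^+ 2) (L2v_sqn xx2).
  have i3 := integrableZR 2 i2.
  rewrite /N_ /D_ -(RintegralZl _ measurableT (L2v_sqn gf2)) -(RintegralZl _ measurableT (L2v_sqn xx2)).
  rewrite -(RintegralZl _ measurableT i2) -RintegralD//.
  apply: le_Esqn => //; first exact: integrableDR.
  move=> w; have -> : grad f (x k.+1 w) = grad f (x k w) + (grad f (x k.+1 w) - grad f (x k w)).
    by rewrite addrC subrK.
  by apply: le_trans (sqnD_le _ _) _; rewrite lerD2l ler_wpM2l.
- have DD2 i l : i \in good -> l \in good -> L2v P (fun w => Dl i w - Dl l w).
    by move=> ig lg; apply: L2vB; exact: Dl2.
  have hs : \sum_(i in good) \sum_(l in good) Esqn P (fun w => Dl i w - Dl l w) <=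
      2 * G%:R * (G%:R * (Lpm ^+ 2 * D_ k)).
    have i1 := integrableZR (Lpm ^+ 2) (L2v_sqn xx2).
    have i2 := integrableZR G%:R i1.
    rewrite /D_ -(RintegralZl _ measurableT (L2v_sqn xx2)) -(RintegralZl _ measurableT i1).
    rewrite -(RintegralZl _ measurableT i2).
    rewrite -[X in X <= _](_ : \int[P]_w (\sum_(i in good) \sum_(l in good)
        sqn (Dl i w - Dl l w)) = _).
      apply: le_Rintegral => //.
      + apply: integrable_sumR => i ig; apply: integrable_sumR => l lg.
        exact: L2v_sqn (DD2 i l ig lg).
      + exact: integrableZR.
      + by move=> w _; exact: hessvar_pairs.
    rewrite Rintegral_sum => [|i ig]; last first.
      by apply: integrable_sumR => l lg; exact: L2v_sqn (DD2 i l ig lg).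
    apply: eq_bigr => i ig; rewrite Rintegral_sum => [//|l lg].
    exact: L2v_sqn (DD2 i l ig lg).
  have q0 : 0 <= 1 - p by rewrite subr_ge0.
  apply: le_trans (_ : (1 - p) * (\sum_(i in good) \sum_(l in good)
     Esqn P (fun w => Dl i w - Dl l w)) + 2 * G%:R * \sum_(i in good) SN i <= _); last first.
    by rewrite lerD2r ler_wpM2l.
  apply: le_trans (_ : \sum_(i in good) \sum_(l in good)
    ((1 - p) * Esqn P (fun w => Dl i w - Dl l w) + (SN i + SN l)) <= _).
    by apply: ler_sum => i ig; apply: ler_sum => l lg; exact: hpair.
  (* Each noise level occurs [G] times as first and [G] times as second member of a pair, hence the
     factor [2 * G]. *)
  under eq_bigr do rewrite big_split /= -mulr_sumr big_split /= sumr_const.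
  rewrite big_split /= -mulr_sumr lerD2l big_split /= sumr_const.
  have mulnE (u : R) : u *+ #|good| = G%:R * u by rewrite mulr_natl.
  rewrite sumrMnl mulnE.
  by rewrite le_eqVlt; apply/orP; left; apply/eqP; ring.
- apply: le_trans hSN _; rewrite ler_wpM2l ?subr_ge0// lerD2r ler_wpM2l//.
  have i1 := integrableZR (L ^+ 2 + Lpm ^+ 2) (L2v_sqn xx2).
  rewrite /D_ -(RintegralZl _ measurableT (L2v_sqn xx2)) -(RintegralZl _ measurableT i1).
  rewrite /Esqn -Rintegral_sum => [|i ig]; last exact: L2v_sqn (Dl2 ig).
  apply: le_Rintegral => //.
  + by apply: integrable_sumR => i ig; exact: L2v_sqn (Dl2 ig).
  + exact: integrableZR.
  + by move=> w _; exact: sum_smooth.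
Qed.

End step.

(** * Descent, Polyak-Lojasiewicz inequality and the rate *)

Context (mu : R).
Hypothesis mu0 : 0 < mu.
Hypothesis pl : forall y, exists xs, (forall z, f xs <= f z) /\
  2 * mu * (f y - f xs) <= sqn (grad f y).
Hypothesis Bp : 96 * B * beta < p.
Hypothesis gamma0 : 0 < gamma.
Let rho := 1 - 96 * B * beta / p.
Hypothesis gammaA : gamma <= 1 / (L + Num.sqrt (2 * A)).
Hypothesis gammamu : gamma <= p / (4 * mu * rho).
Context (xs : 'rV[R]_d) (xs_min : forall z, f xs <= f z).

Let A0 : 0 <= A.
Proof.
have q0 : 0 <= 1 - p by rewrite subr_ge0.
have p0' := ltW p0; have G0' := ltW G0.
have o1 : 0 <= 1 + omega by rewrite addr_ge0.
have sL := sqr_ge0 L; have sLpm := sqr_ge0 Lpm.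
have i1 : 0 <= 1 / (2 * G%:R : R) by rewrite divr_ge0// mulr_ge0.
have i2 : 0 <= omega / (2 * G%:R) by rewrite divr_ge0// mulr_ge0.
have i3 : 0 <= 6 * (1 - p) / p by apply: divr_ge0 => //; exact: mulr_ge0.
have i4 : 0 <= 4 * beta / p by apply: divr_ge0 => //; exact: mulr_ge0.
have i5 : 0 <= 4 * beta * (1 + omega) / p.
  by apply: divr_ge0 => //; apply: mulr_ge0 => //; exact: mulr_ge0.
apply: addr_ge0; first apply: addr_ge0.
- apply: divr_ge0 => //; apply: mulr_ge0 => //; apply: mulr_ge0 => //.
  exact: mulr_ge0.
- by apply: mulr_ge0; [apply: mulr_ge0 => //|]; apply: addr_ge0 => //; exact: mulr_ge0.
- by apply: mulr_ge0 => //; apply: mulr_ge0 => //; exact: addr_ge0.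
Qed.

Let F_ k := \int[P]_w (f (x k w) - f xs).

Let mf k : measurable_fun setT (fun w => f (x k w) - f xs).
Proof.
apply: measurable_funB => //; apply: vec_measurable_continuous.
  exact: PmO (@Pm_x k).
by move=> y; exact: differentiable_continuous.
Qed.

(** The descent lemma at the minimiser bounds the nonnegative gap [f (x k w) - f xs] by a quadratic
    in [x k w - xs]. *)
Let integrable_f k : L2v P (x k) ->
  P.-integrable setT (EFin \o (fun w => f (x k w) - f xs)).
Proof.
move=> x2; have xx2 : L2v P (fun w => x k w - xs) by apply: L2vB => //; exact: L2v_cst.
apply: (@integrable_le _ _ _ _ _ (fun w => dot (grad f xs) (x k w - xs)
    + L / 2 * sqn (x k w - xs))) => //.
- move=> w; rewrite ger0_norm ?subr_ge0//.
  by have := differentiable_descent xs (x k w) L0 df smooth_sqn; lra.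
- apply: integrableDR; first exact: (L2v_dot (L2v_cst P (grad f xs)) xx2).
  by apply: integrableZR; exact: L2v_sqn.
Qed.

Let descent_step k : L2v P (x k) -> L2v P (g k) -> L2v P (x k.+1) ->
  F_ k.+1 <= F_ k - gamma / 2 * N_ k - ((2 * gamma)^-1 - L / 2) * D_ k
    + gamma / 2 * e_ k.
Proof.
move=> x2 g2 x'2.
have gf2 : L2v P (fun w => grad f (x k w)) by exact: (L2v_lip smooth_sqn (@Pm_x k)).
have iF := integrable_f x2; have iF' := integrable_f x'2.
have iN := L2v_sqn gf2; have ie := L2v_sqn (L2vB g2 gf2); have iD := L2v_sqn (L2vB x'2 x2).
have -> : F_ k - gamma / 2 * N_ k - ((2 * gamma)^-1 - L / 2) * D_ k + gamma / 2 * e_ k =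
  F_ k + (- (gamma / 2)) * N_ k + (- ((2 * gamma)^-1 - L / 2)) * D_ k + gamma / 2 * e_ k.
  by rewrite !mulNr.
rewrite /N_ /D_ /e_ /Esqn -(RintegralZl _ measurableT iN) -(RintegralZl _ measurableT iD).
have iN' := integrableZR (- (gamma / 2)) iN.
have iD' := integrableZR (- ((2 * gamma)^-1 - L / 2)) iD.
have ie' := integrableZR (gamma / 2) ie.
rewrite -(RintegralZl _ measurableT ie) /F_.
have i1 := integrableDR iF iN'; have i2 := integrableDR i1 iD'.
rewrite -(RintegralD measurableT iF iN') -(RintegralD measurableT i1 iD').
rewrite -(RintegralD measurableT i2 ie').
apply: le_Rintegral => //; first exact: integrableDR.
move=> w _.
have := differentiable_descent (x k w) (x k.+1 w) L0 df smooth_sqn.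
have -> : x k.+1 w - x k w = - (gamma *: g k w) by rewrite x_S addrAC subrr add0r.
rewrite sqnN sqnZ dotNr dotZr sqnB (dotC (grad f (x k w))) => h.
(* With [x k.+1 w - x k w = - gamma *: g k w], the inner product of [g k w] and the gradient is
   polarised into the squares of both and of their difference; the square of [g k w] is merged into
   the step term. *)
apply: le_trans (_ : f (x k w) - f xs
  - gamma * dot (g k w) (grad f (x k w)) + L / 2 * (gamma ^+ 2 * sqn (g k w)) <= _).
  by move: h; lra.
rewrite le_eqVlt; apply/orP; left; apply/eqP; field.
by rewrite gt_eqF.
Qed.

Let pl_step k : L2v P (x k) -> 2 * mu * F_ k <= N_ k.
Proof.
move=> x2; have iF := integrable_f x2.
have gf2 : L2v P (fun w => grad f (x k w)) by exact: (L2v_lip smooth_sqn (@Pm_x k)).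
rewrite /F_ -(RintegralZl _ measurableT iF); apply: le_Rintegral => //.
- exact: integrableZR.
- exact: L2v_sqn.
(* The minimiser supplied by (A5) may vary with the point, but all minimisers share the same
   value. *)
- move=> w _; have [xs' [xs'_min h]] := pl (x k w).
  have -> : f xs = f xs' by apply/le_anti; rewrite xs_min xs'_min.
  exact: h.
Qed.

Let iterates_L2v : L2v P (g 0%N) -> forall k, L2v P (x k) /\ L2v P (g k).
Proof.
move=> g02; elim=> [|k [x2 g2]]; last by have [] := variance_step x2 g2.
by split => //; rewrite (_ : x 0%N = fun=> x0); [exact: L2v_cst|exact/funext].
Qed.

Let rate_real K : L2v P (g 0%N) ->
  F_ K <= (1 - gamma * mu * rho) ^+ K * (F_ 0%N + 2 * gamma / p * e_ 0%N)
    + 24 * beta * zeta ^+ 2 / (mu * (p - 96 * B * beta)).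
Proof.
move=> /iterates_L2v it.
apply: (lyapunov_rate p0 p1 beta0 mu0 gamma0 L0 A0 Bp gammaA gammamu
  (e := e_) (N := N_) (D := D_)).
- by move=> k; exact: Esqn_ge0.
- by move=> k; exact: Esqn_ge0.
- by move=> k; apply: descent_step; [case: (it k)|case: (it k)|case: (it k.+1)].
- by move=> k; have [x2 g2] := it k; have [] := variance_step x2 g2.
- by move=> k; apply: pl_step; case: (it k).
Qed.

Lemma byz_vr_marina_rate K :
  (\int[P]_w (f (x K w) - f xs)%:E
   <= ((1 - gamma * mu * rho) ^+ K)%:E *
        \int[P]_w (f x0 - f xs + 2 * gamma / p * sqn (g 0%N w - grad f x0))%:E
      + (24 * beta * zeta ^+ 2 / (mu * (p - 96 * B * beta)))%:E)%E.
Proof.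
have gp : 0 < 2 * gamma / p by rewrite divr_gt0// mulr_gt0.
(* Strict positivity matters: an infinite mean of [Phi] must keep the right side infinite, and a
   zero factor would annihilate it. *)
have r0 : 0 < 1 - gamma * mu * rho.
  by have := contraction_le p0 mu0 Bp gammamu; have := p1; rewrite -/rho; lra.
pose Phi w := f x0 - f xs + 2 * gamma / p * sqn (g 0%N w - grad f x0).
have mg0' : vec_measurable (g 0%N) by exact: PmO (@Pm_g 0%N).
have mgg : vec_measurable (fun w => g 0%N w - grad f x0).
  by apply: vec_measurableB => // j; exact: measurable_cst.
have mPhi : measurable_fun setT Phi.
  apply: measurable_funD => //; apply: measurable_funM => //.
  exact: measurable_sqn.
have Phi0 w : 0 <= Phi w.
  by apply: addr_ge0; [rewrite subr_ge0|apply: mulr_ge0; [exact: ltW|exact: sqn_ge0]].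
have [Phioo|] := boolP (\int[P]_w (Phi w)%:E < +oo)%E; last first.
  rewrite -leNgt leye_eq => /eqP ->.
  by rewrite gt0_muley ?lte_fin ?exprn_gt0// addye ?leey// -ltNye ltNyr.
have iPhi := integrable_ge0 mPhi Phi0 Phioo.
(* Since [f x0 - f xs] is nonnegative, [Phi] dominates the squared initial error up to the factor
   [2 * gamma / p]. *)
have gg2 : L2v P (fun w => g 0%N w - grad f x0).
  apply: (@L2v_le _ _ _ _ _ _ (fun w => (2 * gamma / p)^-1 * Phi w)) => //.
    move=> w; rewrite ler_pdivlMl// lerDr subr_ge0//.
  exact: integrableZR.
have g02 : L2v P (g 0%N).
  rewrite (_ : g 0%N = fun w => (g 0%N w - grad f x0) + grad f x0).
    by apply: L2vD => //; exact: L2v_cst.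
  by apply/funext => w; rewrite subrK.
have [x2 _] := iterates_L2v g02 K.
rewrite -(EFin_Rintegral (integrable_f x2)) -(EFin_Rintegral iPhi) -EFinM -EFinD lee_fin.
apply: le_trans (rate_real K g02) _; rewrite le_eqVlt; apply/orP; left; apply/eqP.
congr (_ * _ + _); rewrite /Phi /F_ /e_ /Esqn.
under eq_Rintegral do rewrite x_0.
under [X in _ + _ * X]eq_Rintegral do rewrite x_0.
have igg := L2v_sqn gg2.
have h := RintegralD measurableT (integrable_cstR P (f x0 - f xs))
  (integrableZR (2 * gamma / p) igg).
by apply: etrans (esym h); rewrite (RintegralZl _ measurableT igg).
Qed.

End byz_vr_marina.

Theorem theorem2
  (R : realType) (d n m b : nat) (good : {set 'I_n}) (delta : R)
  (fij : 'I_n -> 'I_m -> 'rV[R]_d -> R)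
  (L B zeta Lpm LLpm mu omega c p gamma : R)
  (dO : measure_display) (Om : measurableType dO) (P : probability Om R)
  (dS : measure_display) (S : measurableType dS) (nuS : 'I_n -> probability S R)
  (Dhat : 'I_n -> 'rV[R]_d -> 'rV[R]_d -> S -> 'rV[R]_d)
  (dU : measure_display) (U : measurableType dU) (nuU : probability U R)
  (Q : 'rV[R]_d -> U -> 'rV[R]_d)
  (ARAgg : ('I_n -> 'rV[R]_d) -> 'rV[R]_d)
  (F0 : set (set Om)) (cc : nat -> Om -> bool)
  (xi : nat -> 'I_n -> Om -> S) (eta : nat -> 'I_n -> Om -> U)
  (x0 : 'rV[R]_d) (x g : nat -> Om -> 'rV[R]_d)
  (gi byz : nat -> 'I_n -> Om -> 'rV[R]_d) :
  let G := #|good| in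
  let fi := fun (i : 'I_n) (y : 'rV[R]_d) => m%:R^-1 * \sum_(j < m) fij i j y in
  let f := fun y : 'rV[R]_d => G%:R^-1 * \sum_(i in good) fi i y in
  let past := bvr_past good F0 cc xi eta in
  let gbar := fun k w => G%:R^-1 *: \sum_(i in good) gi k i w in
  let A := 48 * B * L ^+ 2 * c * delta / p
         + 6 * (1 - p) / p * (4 * c * delta / p + 1 / (2 * G%:R))
             * (omega * L ^+ 2 + (1 + omega) * LLpm ^+ 2 / b%:R)
         + 6 * (1 - p) / p * (4 * c * delta * (1 + omega) / p + omega / (2 * G%:R))
             * Lpm ^+ 2 in
  let rho := 1 - 96 * B * c * delta / p in
  (* workers *)
  (1 < G)%N ->
  0 <= delta -> delta < 1 / 2 ->
  #|~: good|%:R <= delta * n%:R ->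
  (0 < m)%N ->
  (forall i, i \in good -> forall (j : 'I_m) (y : 'rV[R]_d), differentiable (fij i j) y) ->
  (* (A1) *)
  (forall y z, enorm (grad f y - grad f z) <= L * enorm (y - z)) ->
  (exists lb : R, forall y, lb <= f y) ->
  (* (A2) *)
  0 <= B -> 0 <= zeta ->
  (forall y, G%:R^-1 * \sum_(i in good) sqn (grad (fi i) y - grad f y)
               <= B * sqn (grad f y) + zeta ^+ 2) ->
  (* (A3) *)
  0 <= Lpm ->
  (forall y z, G%:R^-1 * \sum_(i in good) sqn (grad (fi i) y - grad (fi i) z)
                 - sqn (grad f y - grad f z) <= Lpm ^+ 2 * sqn (y - z)) ->
  (* (A4) *)
  (0 < b)%N -> 0 <= LLpm ->
  (forall i, i \in good -> forall j : 'I_d,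
     measurable_fun setT
       (fun z : (vecM R d * vecM R d * S)%type => Dhat i z.1.1 z.1.2 z.2 0 j)) ->
  (forall i, i \in good -> forall (y z : 'rV[R]_d) (j : 'I_d),
     (nuS i).-integrable setT (fun s => (Dhat i y z s 0 j)%:E) /\
     (\int[nuS i]_s (Dhat i y z s 0 j)%:E
        = ((grad (fi i) y - grad (fi i) z) 0 j)%:E)%E) ->
  (forall y z : 'rV[R]_d,
     ((G%:R^-1)%:E * \sum_(i in good)
        \int[nuS i]_s (sqn (Dhat i y z s - (grad (fi i) y - grad (fi i) z)))%:E
      <= (LLpm ^+ 2 / b%:R * sqn (y - z))%:E)%E) ->
  (* (A5) *)
  0 < mu ->
  (forall y, exists xs, (forall z, f xs <= f z) /\
                        2 * mu * (f y - f xs) <= sqn (grad f y)) ->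
  (* compressor *)
  0 <= omega ->
  (forall j : 'I_d,
     measurable_fun setT (fun z : (vecM R d * U)%type => Q z.1 z.2 0 j)) ->
  (forall (y : 'rV[R]_d) (j : 'I_d),
     nuU.-integrable setT (fun u => (Q y u 0 j)%:E) /\
     (\int[nuU]_u (Q y u 0 j)%:E = (y 0 j)%:E)%E) ->
  (forall y : 'rV[R]_d,
     (\int[nuU]_u (sqn (Q y u - y))%:E <= (omega * sqn y)%:E)%E) ->
  (* the randomness of the method *)
  0 < p -> p <= 1 ->
  sigma_algebra setT F0 ->
  (forall k, measurable_fun setT (cc k)) ->
  (forall k, P [set w | cc k w] = p%:E) ->
  (forall k i, i \in good -> measurable_fun setT (xi k i)) ->
  (forall k i, i \in good -> forall C, measurable C -> P (xi k i @^-1` C) = nuS i C) ->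
  (forall k i, i \in good -> measurable_fun setT (eta k i)) ->
  (forall k i, i \in good -> forall C, measurable C -> P (eta k i @^-1` C) = nuU C) ->
  mutually_independent P (bvr_sys good F0 cc xi eta) ->
  (* the iterations of Byz-VR-MARINA *)
  (forall w, x 0%N w = x0) ->
  vec_meas_wrt F0 (g 0%N) ->
  (forall k w, x k.+1 w = x k w - gamma *: g k w) ->
  (forall k i w, i \in good ->
     gi k.+1 i w = if cc k w then grad (fi i) (x k.+1 w)
                   else g k w + Q (Dhat i (x k.+1 w) (x k w) (xi k i w)) (eta k i w)) ->
  (forall k i, i \notin good -> vec_meas_wrt (past k.+1) (byz k.+1 i)) ->
  (forall k w, g k.+1 w = ARAgg (fun i => if i \in good then gi k.+1 i w
                                          else byz k.+1 i w)) ->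
  (forall k, vec_meas_wrt (past k.+1) (g k.+1)) ->
  (* robustness (R) of the aggregator *)
  0 < c ->
  (forall k,
     (\int[P]_w (sqn (g k.+1 w - gbar k.+1 w))%:E
      <= (c * delta / (G%:R * (G%:R - 1)))%:E *
         \sum_(i in good) \sum_(l in good)
            \int[P]_w (sqn (gi k.+1 i w - gi k.+1 l w))%:E)%E) ->
  (* stepsize *)
  96 * c * B * delta < p ->
  0 < gamma ->
  gamma <= 1 / (L + Num.sqrt (2 * A)) ->
  gamma <= p / (4 * mu * rho) ->
  forall xs : 'rV[R]_d, (forall z, f xs <= f z) ->
  forall K : nat,
    (\int[P]_w (f (x K w) - f xs)%:E
     <= ((1 - gamma * mu * rho) ^+ K)%:E *
          \int[P]_w (f x0 - f xs + 2 * gamma / p * sqn (g 0%N w - grad f x0))%:E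
        + (24 * c * delta * zeta ^+ 2 / (mu * (p - 96 * B * c * delta)))%:E)%E.
Proof.
move=> G fi f past gbar A rho G1 delta0 _ _ _ dfij smooth _ B0 _ hetero _ hessvar b0 _.
move=> mDhat Dhat_mean Dhat_var mu0 pl omega0 mQ Q_mean Q_var p0 p1 F0s mcc Pcc _ xi_law _ eta_law.
move=> indep x_0 mg0 x_S gi_S _ _ mg c0 robust Bp gamma0 gammaA gammamu xs xs_min K.
have rhoE : rho = 1 - 96 * B * (c * delta) / p by rewrite /rho !mulrA.
have Bp' : 96 * B * (c * delta) < p by move: Bp; rewrite !mulrA [96 * c * B]mulrAC.
have beta0 : 0 <= c * delta by rewrite mulr_ge0// ltW.
(* The sign of [L] is not given by (A1) as stated, whereas the rate is established for nonnegative
   [L]. *)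
have [L0|Lneg] := lerP 0 L.
  have := @byz_vr_marina_rate R d n m good fij L B zeta Lpm (LLpm ^+ 2 / b%:R) omega
    (c * delta) p gamma dO Om P dS S nuS Dhat dU U nuU Q F0 cc xi eta x0 x g gi
    G1 dfij L0 smooth hetero hessvar (divr_ge0 (sqr_ge0 _) (ler0n _ _)) mDhat Dhat_mean
    Dhat_var omega0 mQ Q_mean Q_var F0s mcc Pcc xi_law eta_law indep x_0 mg0 x_S gi_S mg
    robust p0 p1 beta0 B0 mu mu0 pl Bp' gamma0.
  rewrite -rhoE !mulrA; apply => //.
  move: gammaA; rewrite /A /G !mulrA; exact.
(* a negative [L] forces the space to be a point *)
have eq_all (u v : 'rV[R]_d) : u = v.
  have h : 0 <= L * enorm (u - v) by apply: le_trans (smooth u v); exact: sqrtr_ge0.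
  have u0 : enorm (u - v) = 0.
    by apply/le_anti; rewrite sqrtr_ge0 andbT; move: h; rewrite nmulr_rge0.
  apply/eqP; rewrite -subr_eq0; apply/eqP/sqn_eq0.
  by rewrite -[LHS](sqr_sqrtr (sqn_ge0 _)) -/(enorm _) u0 expr0n.
have -> : (\int[P]_w (f (x K w) - f xs)%:E = 0)%E.
  by rewrite (eq_integral (cst 0%E)) ?integral0// => w _; rewrite (eq_all (x K w) xs) subrr.
(* The left side being 0, it remains to see that the right side is nonnegative; [contraction_le]
   keeps the factor at least [3 / 4]. *)
rewrite adde_ge0//.
  apply: mule_ge0.
    rewrite lee_fin exprn_ge0//.
    have := contraction_le p0 mu0 Bp'; rewrite -rhoE => /(_ _ gammamu).
    by lra.
  apply: integral_ge0 => w _; rewrite lee_fin addr_ge0 ?subr_ge0//.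
  by apply: mulr_ge0; [apply: divr_ge0; [apply: mulr_ge0 => //|]; exact: ltW|exact: sqn_ge0].
rewrite lee_fin; apply: divr_ge0.
  by apply: mulr_ge0; [rewrite -mulrA mulr_ge0|exact: sqr_ge0].
by apply: mulr_ge0; [exact: ltW|rewrite subr_ge0 -!mulrA [B * _]mulrA mulrA; move/ltW: Bp'; rewrite !mulrA].
Qed.
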